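(* Let $\mathbb{K}$ be an algebraically closed field, let $p$ be an odd positive integer and let $q\in\mathbb{K}\setminus\{0\}$ be not a root of unity. Let $A$ be the quantum torus with generators $z_1^{\pm1},\dots,z_p^{\pm 1}$ and relations $z_iz_j=q_{ij}z_jz_i$ for $1\leq j<i\leq p$, where $q_{ij}=q^{-1}$ if $i$ is even and $j$ is odd, and $q_{ij}=1$ otherwise. Let $\alpha$ be the $\mathbb{K}$-automorphism of $A$ with $\alpha(z_i)=z_i$ for $i$ even and $\alpha(z_i)=q^{-1}z_i$ for $i$ odd. Let $u=q^{\frac{p-1}{2}}z_p^{-1}+qz_p\in Z(A)$, let $v=u-\alpha(u)=(1-q)(q^{\frac{p-1}{2}}z_p^{-1}-z_p)$, let $R=R(A,\alpha,v,1)$ be the ambiskew polynomial ring and let $z=xy-u$ be its Casimir element. Let $m\geq 1$ be an integer, and let $F_{m,1}$ and $F_{m,-1}$ be the height two prime ideals of $R$ defined, for $\varepsilon\in\{1,-1\}$, by $$F_{m,\varepsilon}=\pi_\varepsilon^{-1}\bigl(J((z_p-\varepsilon q^{\frac{p+2m-3}{4}})A)\bigr),$$ where $\pi_\varepsilon:R\to R/(z-\lambda_\varepsilon)R=W(A,\alpha,u+\lambda_\varepsilon)$ is the canonical epimorphism for $\lambda_\varepsilon=-\varepsilon q^{\frac{p-2m+1}{4}}(q^m+1)$. Then $F_{m,1}$ and $F_{m,-1}$ have right Goldie rank $m$; that is, the rings $R/F_{m,1}$ and $R/F_{m,-1}$ have right Goldie rank $m$.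
   Context: The ambiskew polynomial algebra $R(A,\alpha,v,1)$ ($v$ central in $A$) is the iterated skew polynomial ring $A[y;\alpha][x;\beta,\delta]$, where $\beta=\alpha^{-1}$ on $A$, $\beta(y)=y$, and $\delta$ is the $\beta$-derivation of $A[y;\alpha]$ with $\delta(A)=0$ and $\delta(y)=v$. Thus $ya=\alpha(a)y$ and $xa=\alpha^{-1}(a)x$ for all $a\in A$, and $xy=yx+v$. When $v=u-\alpha(u)$ with $u$ central, the Casimir element $z=xy-u$ is central in $R$. For $w\in A$ central, the generalized Weyl algebra $W(A,\alpha,w)$ is the ring extension of $A$ generated by $X,Y$ subject to $YX=\alpha(w)$, $XY=w$, $Ya=\alpha(a)Y$, $Xa=\alpha^{-1}(a)X$ for $a\in A$. For $\lambda\in\mathbb{K}$, $R/(z-\lambda)R$ is identified with $W(A,\alpha,u+\lambda)$ via $x\mapsto X$, $y\mapsto Y$. $W(A,\alpha,w)$ is $\mathbb{Z}$-graded with degree $0$ component $A$ and, for $i>0$, degree $i$ component $AY^i$ and degree $-i$ component $AX^i$. For the given $m$ and $w=u+\lambda_\varepsilon$, one has $wA+\alpha^m(w)A=(z_p-\varepsilon q^{\frac{p+2m-3}{4}})A=:M$, and $J(M)$ denotes the $\mathbb{Z}$-graded ideal $\bigoplus_{i\in\mathbb{Z}}J_i$ of $W(A,\alpha,w)$ with, for $i\geq0$, $J_i=I_iY^i$ and $J_{-i}=I_{-i}X^i$, where $I_i=I_{-i}=A$ if $i\geq m$, and $I_i=\bigcap_{\ell=0}^{m-1-i}\alpha^{-\ell}(M)$,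 $I_{-i}=\bigcap_{\ell=i}^{m-1}\alpha^{-\ell}(M)$ if $0\leq i\leq m-1$; it is the unique non-zero prime ideal of $W(A,\alpha,w)$. A fixed square root $q^{1/2}$ of $q$ in $\mathbb{K}$ is chosen; since $p$ is odd, $p-2m+1$ and $p+2m-3$ are even, and $q^{k/4}$ for even $k$ means $(q^{1/2})^{k/2}$. The right Goldie rank of a ring is the uniform (Goldie) dimension of the ring as a right module over itself; the right Goldie rank of a prime ideal $P$ of $R$ means that of $R/P$. *)

(* Defs.v *)
From HB Require Import structures.
From mathcomp Require Import all_boot all_order all_algebra.
From mathcomp Require Import boolp classical_sets.

Set Implicit Arguments.
Unset Strict Implicit.
Unset Printing Implicit Defensive.

Import GRing.Theory.

Local Open Scope classical_set_scope.
Local Open Scope ring_scope.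

(* The algebras below are specified up to isomorphism: the quantum torus and
   the generalized Weyl algebra by the universal property of their
   presentation, skew polynomial rings as left-free ring extensions, and
   quotient rings as surjections with prescribed kernel. *)

Section QuotientRing.
Variables (R S : nzRingType) (I : set R) (f : {rmorphism R -> S}).

(* f exhibits S as R/I; in particular I is a proper two-sided ideal *)
Definition is_quotient_ring : Prop :=
  (forall s, exists r, f r = s) /\ (forall r, f r = 0 <-> I r).

End QuotientRing.

Section GoldieDimension.
Variables (T : pzRingType) (V : lmodType T).

Definition is_submodule (N : set V) : Prop :=
  [/\ N 0,
      forall u v, N u -> N v -> N (u + v)
    & forall a u, N u -> N (a *: u)].

Definition is_uniform (U : set V) : Prop :=
  [/\ is_submodule U, U <> [set 0]
    & forall N N' : set V, is_submodule N -> is_submodule N' ->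
        N `<=` U -> N' `<=` U -> N <> [set 0] -> N' <> [set 0] ->
        N `&` N' <> [set 0]].

Definition is_essential (E : set V) : Prop :=
  is_submodule E /\
  forall N : set V, is_submodule N -> N <> [set 0] -> E `&` N <> [set 0].

Definition independent n (U : 'I_n -> set V) : Prop :=
  forall u : 'I_n -> V, (forall i, U i (u i)) ->
    \sum_i u i = 0 -> forall i, u i = 0.

Definition sum_submod n (U : 'I_n -> set V) : set V :=
  [set v | exists2 u : 'I_n -> V, (forall i, U i (u i)) & v = \sum_i u i].

(* V has an essential submodule that is a direct sum of n uniform ones *)
Definition has_uniform_dim (n : nat) : Prop :=
  exists U : 'I_n -> set V,
    [/\ forall i, is_uniform (U i), independent U
      & is_essential (sum_submod U)].

End GoldieDimension.

(* A right S-module is a left module over the converse ring S^c; on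
   (S^c)^o one has a *: v = v * a, with the product taken in S. *)
Definition has_right_goldie_rank (S : nzRingType) (n : nat) : Prop :=
  has_uniform_dim ((S^c)^o : lmodType S^c) n.

Definition quotient_has_right_goldie_rank
    (R : nzRingType) (I : set R) (n : nat) : Prop :=
  exists (S : nzRingType) (f : {rmorphism R -> S}),
    is_quotient_ring I f /\ has_right_goldie_rank S n.

(* S = B[x; sigma, delta], where B is embedded in S by iota *)
Record is_skew_poly (B S : nzRingType) (sigma : {rmorphism B -> B})
    (delta : B -> B) (iota : {rmorphism B -> S}) (x : S) : Prop := {
  skew_derD : {morph delta : a b / a + b};
  skew_derM : forall a b, delta (a * b) = sigma a * delta b + delta a * b;
  skew_inj : injective iota;
  skew_comm : forall a, x * iota a = iota (sigma a) * x + iota (delta a);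
  (* S is left B-free on the powers of x: (map_poly iota P).[x] is
     \sum_i iota P`_i * x ^+ i, coefficients on the left *)
  skew_free : forall s, exists! P : {poly B}, s = (map_poly iota P).[x]
}.

(* R = R(A, alpha, v, 1) = A[y; alpha][x; beta, delta], with alphaV the
   inverse of alpha; the intermediate ring A[y; alpha] is S *)
Definition is_ambiskew (A R : nzRingType) (alpha alphaV : {rmorphism A -> A})
    (v : A) (iota : {rmorphism A -> R}) (x y : R) : Prop :=
  exists (S : nzRingType) (j : {rmorphism A -> S}) (y0 : S)
         (beta : {rmorphism S -> S}) (delta : S -> S)
         (k : {rmorphism S -> R}),
  [/\ is_skew_poly alpha (fun=> 0) j y0,
      (forall a, beta (j a) = j (alphaV a)) /\ beta y0 = y0,
      (forall a, delta (j a) = 0) /\ delta y0 = j v,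
      is_skew_poly beta delta k x
    & (forall a, iota a = k (j a)) /\ y = k y0].

Section GeneralizedWeylAlgebra.
Variables (A : nzRingType) (alpha alphaV : {rmorphism A -> A}) (w : A).

Definition gwa_relations (B : nzRingType) (f : {rmorphism A -> B})
    (X Y : B) : Prop :=
  [/\ Y * X = f (alpha w),
      X * Y = f w,
      forall a, Y * f a = f (alpha a) * Y
    & forall a, X * f a = f (alphaV a) * X].

Record is_gwa (W : nzRingType) (iota : {rmorphism A -> W}) (X Y : W)
    : Prop := {
  gwa_inj : injective iota;
  gwa_rel : gwa_relations iota X Y;
  gwa_univ : forall (B : nzRingType) (f : {rmorphism A -> B}) (X' Y' : B),
    gwa_relations f X' Y' ->
    exists g : {rmorphism W -> B},
      [/\ forall a, g (iota a) = f a, g X = X' & g Y = Y'] /\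
      forall h : {rmorphism W -> B},
        [/\ forall a, h (iota a) = f a, h X = X' & h Y = Y'] -> h =1 g
}.

End GeneralizedWeylAlgebra.

Section IdealJ.
Variables (A W : nzRingType) (alphaV : A -> A) (iota : A -> W) (X Y : W).
Variables (M : set A) (m : nat).

(* I_i and I_{-i} for i >= 0, where alpha^{-l}(M) is the image of M *)
Definition coef_pos (i : nat) : set A :=
  if (m <= i)%N then setT
  else \bigcap_(l in [set l | (l <= m - 1 - i)%N]) (iter l alphaV @` M).

Definition coef_neg (i : nat) : set A :=
  if (m <= i)%N then setT
  else \bigcap_(l in [set l | (i <= l <= m - 1)%N]) (iter l alphaV @` M).

(* sums of homogeneous elements of degrees 0, ..., n-1 and -1, ..., -(n-1) *)
Definition ideal_J : set W :=
  [set r | exists (n : nat) (a b : nat -> A),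
     [/\ forall i, coef_pos i (a i),
         forall i, coef_neg i (b i)
       & r = \sum_(0 <= i < n) iota (a i) * Y ^+ i
             + \sum_(1 <= i < n) iota (b i) * X ^+ i]].

End IdealJ.

(* The generators are indexed from 1 to p; values of z, zV at other indices
   are irrelevant. zV i is the inverse of z i. *)
Section QuantumTorus.
Variables (K : fieldType) (p : nat) (q : K).

Definition qcoef (i j : nat) : K := if ~~ odd i && odd j then q^-1 else 1.

Definition torus_relations (B : algType K) (z zV : nat -> B) : Prop :=
  (forall i, (1 <= i <= p)%N -> z i * zV i = 1 /\ zV i * z i = 1) /\
  (forall i j, (1 <= j < i)%N -> (i <= p)%N ->
     z i * z j = qcoef i j *: (z j * z i)).

Definition is_quantum_torus (A : algType K) (z zV : nat -> A) : Prop :=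
  torus_relations z zV /\
  forall (B : algType K) (b bV : nat -> B), torus_relations b bV ->
    exists g : {lrmorphism A -> B},
      (forall i, (1 <= i <= p)%N -> g (z i) = b i) /\
      forall h : {lrmorphism A -> B},
        (forall i, (1 <= i <= p)%N -> h (z i) = b i) -> h =1 g.

End QuantumTorus.

Section TorusElements.
Variables (K : fieldType) (p : nat) (q : K).

(* q^(k/4) for even k, in terms of a square root sq of q *)
Definition qpow4 (sq : K) (k : int) : K := sq ^ (k %/ 2)%Z.

Definition torus_u (A : algType K) (z zV : nat -> A) : A :=
  q ^+ (p.-1)./2 *: zV p + q *: z p.

Definition lambda_eps (sq : K) (m : nat) (eps : K) : K :=
  - eps * qpow4 sq (p%:Z - 2 * m%:Z + 1) * (q ^+ m + 1).

Definition gen_M (sq : K) (m : nat) (eps : K) (A : algType K)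
    (z : nat -> A) : A :=
  z p - (eps * qpow4 sq (p%:Z + 2 * m%:Z - 3))%:A.

End TorusElements.

Definition right_multiples (R : nzRingType) (c : R) : set R :=
  [set c * a | a in setT].

(* Main.v *)
(** Let M = (z_p - t)A, so that M = wA + alpha^m(w)A. The quotient D = A/M is a
    quantum torus in z_1, ..., z_(p-1), hence a right Ore domain. The m
    homomorphisms a |-> alpha^i(a) + M, 0 <= i < m, placed on a diagonal, extend
    to a homomorphism W -> M_m(D): send Y to the sum of the E_(i,i+1) and X to
    the sum of the d_i E_(i,i-1), where the image d_i of alpha^i(w) in D is a
    scalar, equal to -eps q^((p-2m+1)/4) (q^i - 1) (q^(m-i) - 1). It vanishes
    exactly at i = 0 and i = m, which makes the defining relations hold, the map
    surjective and its kernel J(M). So R/F is isomorphic to M_m(D), which is the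
    direct sum of its m rows, and these are uniform because D is right Ore. *)

Require Import Defs.
From HB Require Import structures.
From mathcomp Require Import all_boot all_order all_algebra.
From mathcomp Require Import boolp classical_sets.
From mathcomp Require Import functions zify ring.

Set Implicit Arguments.
Unset Strict Implicit.
Unset Printing Implicit Defensive.

Import GRing.Theory.

Local Open Scope classical_set_scope.
Local Open Scope ring_scope.

(** * Twisted group algebras *)

(** The universal property of the torus bounds [A] from above: it yields normal forms, but not that
    the monomials stay independent modulo [z_p - t]. Hence [D] is built as a concrete algebra of
    operators on functions on Z^(p-1), where independence is read off by evaluating at one function.
    Comparing the normal form of [A] modulo [z_p - t] with that basis shows that the kernel of
    [A -> D] is exactly [M].

    For [W] the universal property gives maps out of it, but no decomposition into the terms [a Y^i]
    and [b X^i]. This decomposition is pushed forward from [R], whose elements expand in the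
    products [y^l x^i].

    The Ore condition is a growth argument. A lexicographic order makes [D] a domain, and the number
    of monomials in a cube grows only polynomially, which leaves no room for two right ideals with
    zero intersection.

    The kernel of [W -> M_m(D)] is computed diagonal by diagonal: degree k lands on the k-th
    superdiagonal, degree -k on the k-th subdiagonal, and the intersections defining the components
    of [J(M)] run over exactly the rows that these diagonals meet. *)

Record bicharacter (K : fieldType) (G : zmodType) := Bicharacter {
  bichar :> G -> G -> K;
  bichar_neq0 : forall g h, bichar g h != 0;
  bicharDl : forall g g' h, bichar (g + g') h = bichar g h * bichar g' h;
  bicharDr : forall g h h', bichar g (h + h') = bichar g h * bichar g h'
}.

Section TwistedGroupAlgebra.
Variables (K : fieldType) (G : zmodType) (c : bicharacter K G).

Let V := G -> K^o.

(** The basis element of degree [g] is realized as a translation weighted by the bicharacter. The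
    product is then composition of operators, so associativity comes for free, and the twisting
    factor appears when a weight is moved past a translation. *)
Definition shift_op (g : G) : V -> V := 
  fun phi h => @GRing.mul K (c g h) (phi (h - g)).

Let linE (a : K) (phi psi : V) h : (a *: phi + psi) h = a * phi h + psi h :> K.
Proof. by []. Qed.

Lemma bichar0l h : c 0 h = 1.
Proof.
by apply: (mulfI (bichar_neq0 c 0 h)); rewrite mulr1 -bicharDl addr0.
Qed.

Lemma bicharNr g h : c g (- h) = (c g h)^-1.
Proof.
have c0 : c g 0 = 1.
  by apply: (mulfI (bichar_neq0 c g 0)); rewrite mulr1 -bicharDr addr0.
apply: (mulfI (bichar_neq0 c g h)).
by rewrite -bicharDr subrr c0 divff ?bichar_neq0.
Qed.

Lemma shift_opM g g' phi h :
  shift_op g (shift_op g' phi) h = (c g' g)^-1 * shift_op (g + g') phi h.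
Proof.
rewrite /shift_op bicharDr bicharNr bicharDl opprD addrA; ring.
Qed.

Definition comb (s : seq (K * G)) : V -> V :=
  \sum_(x <- s) x.1 *: shift_op x.2.

Lemma combE s phi h : comb s phi h = \sum_(x <- s) x.1 * shift_op x.2 phi h.
Proof. by rewrite /comb !fct_sumE. Qed.

Definition is_comb : pred (V -> V) := [pred f | `[< exists s, f = comb s >]].

Lemma comb_is_comb s : is_comb (comb s).
Proof. by apply/asboolP; exists s. Qed.

Lemma is_comb_submod : subsemimod_closed is_comb.
Proof.
split; first split.
- by apply/asboolP; exists [::]; rewrite /comb big_nil.
- move=> f g /asboolP[s ->] /asboolP[t ->]; apply/asboolP; exists (s ++ t).
  by rewrite /comb big_cat.
- move=> a f /asboolP[s ->]; apply/asboolP.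
  exists [seq (a * x.1, x.2) | x <- s].
  by rewrite /comb big_map scaler_sumr; apply: eq_bigr => x _; rewrite scalerA.
Qed.

HB.instance Definition _ :=
  GRing.isSubSemiModClosed.Build K (V -> V : lmodType K) is_comb is_comb_submod.

Definition twalg := {f : V -> V | is_comb f}.
HB.instance Definition _ := SubChoice.on twalg.
HB.instance Definition _ := [SubChoice_isSubLmodule of twalg by <:].

Lemma comb_linear s a phi psi : comb s (a *: phi + psi) = a *: comb s phi + comb s psi.
Proof.
apply/funext => h; rewrite linE !combE.
rewrite mulr_sumr -big_split /=; apply: eq_bigr => x _; rewrite /shift_op.
rewrite linE; ring.
Qed.

Lemma twalg_linear (f : twalg) a phi psi :
  val f (a *: phi + psi) = a *: val f phi + val f psi.
Proof. by case: f => f /= /asboolP[s ->]; apply: comb_linear. Qed.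

Lemma comb_comp s t : comb s \o comb t =
  comb [seq (x.1 * y.1 * (c y.2 x.2)^-1, x.2 + y.2) | x <- s, y <- t].
Proof.
apply/funext => phi; apply/funext => h.
rewrite combE big_allpairs_dep /= combE; apply: eq_bigr => x _.
rewrite {1}/shift_op combE !mulr_sumr; apply: eq_bigr => y _ /=.
rewrite -[RHS]mulrA -shift_opM /shift_op; ring.
Qed.

Fact twalg_mul_subproof (f g : twalg) : is_comb (val f \o val g).
Proof.
case: f g => f /= /asboolP[s ->] [g /= /asboolP[t ->]].
by rewrite comb_comp comb_is_comb.
Qed.
Definition twalg_mul (f g : twalg) : twalg :=
  exist (fun f => is_comb f) _ (twalg_mul_subproof f g).

Fact shift_op_subproof g : is_comb (shift_op g).
Proof.
by apply/asboolP; exists [:: (1, g)]; rewrite /comb big_seq1 scale1r.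
Qed.
Definition mono g : twalg := exist (fun f => is_comb f) _ (shift_op_subproof g).

Lemma shift_op0 : shift_op 0 = id.
Proof.
by apply/funext => phi; apply/funext => h; rewrite /shift_op bichar0l subr0 mul1r.
Qed.

Fact twalg_mulA : associative twalg_mul.
Proof. by move=> f g h; apply/val_inj. Qed.
Fact twalg_mul1 : left_id (mono 0) twalg_mul.
Proof. by move=> f; apply/val_inj; rewrite /= shift_op0. Qed.
Fact twalg_1mul : right_id (mono 0) twalg_mul.
Proof. by move=> f; apply/val_inj; rewrite /= shift_op0. Qed.
Fact twalg_mulDl : left_distributive twalg_mul +%R.
Proof. by move=> f g h; apply/val_inj. Qed.
Fact twalg_mulDr : right_distributive twalg_mul +%R.
Proof.
move=> f g h; apply/val_inj/funext => phi /=.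
by have := twalg_linear f 1 (val g phi) (val h phi); rewrite !scale1r.
Qed.
Fact twalg_1_neq0 : mono 0 != 0.
Proof.
apply/eqP => /(congr1 val) /=; rewrite shift_op0.
by move=> /(congr1 (fun f : V -> V => f (fun=> 1) 0)) /eqP; rewrite oner_eq0.
Qed.

HB.instance Definition _ := GRing.Zmodule_isNzRing.Build twalg
  twalg_mulA twalg_mul1 twalg_1mul twalg_mulDl twalg_mulDr twalg_1_neq0.

Fact twalg_scaleAl a (f g : twalg) : a *: (f * g) = (a *: f) * g.
Proof. by apply/val_inj. Qed.
HB.instance Definition _ := GRing.Lmodule_isLalgebra.Build K twalg twalg_scaleAl.
Fact twalg_scaleAr a (f g : twalg) : a *: (f * g) = f * (a *: g).
Proof.
apply/val_inj/funext => phi.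
have f0 : val f 0 = 0.
  have := twalg_linear f (-1) 0 0.
  by rewrite scaler0 addr0 scaleN1r addNr.
by have := twalg_linear f a (val g phi) 0; rewrite f0 !addr0 => /esym.
Qed.
HB.instance Definition _ := GRing.Lalgebra_isAlgebra.Build K twalg twalg_scaleAr.

Lemma monoM g h : mono g * mono h = (c h g)^-1 *: mono (g + h).
Proof.
apply/val_inj/funext => phi; apply/funext => k; rewrite linearZ /=.
exact: shift_opM.
Qed.

(** Applied to the indicator of 0, [mono h] gives a function supported at [h] with value [c h h]
    there; the prefactor normalizes this value to 1. *)
Definition tcoef (g : G) (f : twalg) : K :=
  (c g g)^-1 * val f (fun h => (h == 0)%:R) g.

Lemma tcoef_is_linear g : scalar (tcoef g).
Proof.
move=> a f f'; rewrite /tcoef linearP /=.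
rewrite [X in _ * X](linE a (val f _) (val f' _)) mulrDr; congr (_ + _).
exact: mulrCA.
Qed.
HB.instance Definition _ g :=
  GRing.isLinear.Build K twalg K^o _ (tcoef g) (tcoef_is_linear g).

Lemma tcoefZ g a f : tcoef g (a *: f) = a * tcoef g f.
Proof. exact: linearZ. Qed.

Lemma tcoef0 g : tcoef g 0 = 0.
Proof. exact: linear0. Qed.

Lemma tcoef_sum (I : Type) (r : seq I) (P : pred I) g (F : I -> twalg) :
  tcoef g (\sum_(i <- r | P i) F i) = \sum_(i <- r | P i) tcoef g (F i).
Proof. exact: raddf_sum. Qed.

Lemma tcoef_mono g h : tcoef h (mono g) = (h == g)%:R.
Proof.
rewrite /tcoef /= /shift_op subr_eq0; case: eqP => [->|_]; last by rewrite !mulr0.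
by rewrite mulr1 mulVf ?bichar_neq0.
Qed.

Lemma twalg_comb (f : twalg) :
  exists s : seq (K * G), f = \sum_(x <- s) x.1 *: mono x.2.
Proof.
case: f => f /[dup] /asboolP[s fE] Pf; exists s.
apply/val_inj; rewrite raddf_sum [LHS]fE; by apply: eq_bigr.
Qed.

(** A combination of an arbitrary family [w] depends only on the corresponding combination of the
    [mono g]. A relation that holds in the twisted algebra can thus be transported to any family
    indexed by [G]. *)
Lemma lincomb_collect (U : lmodType K) (w : G -> U) (s : seq (K * G)) :
  \sum_(x <- s) x.1 *: w x.2 = \sum_(g <- undup (unzip2 s))
    tcoef g (\sum_(x <- s) x.1 *: mono x.2) *: w g.
Proof.
under [RHS]eq_bigr => g _ do rewrite tcoef_sum scaler_suml.
rewrite exchange_big big_seq [RHS]big_seq; apply: eq_bigr => x xs /=.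
rewrite (bigD1_seq x.2) ?undup_uniq //= ?mem_undup ?map_f //.
rewrite tcoefZ tcoef_mono eqxx mulr1 big1 ?addr0 // => g /negPf gx.
by rewrite tcoefZ tcoef_mono gx mulr0 scale0r.
Qed.

Lemma twalg_tcoef (f : twalg) : exists2 s : seq G, uniq s &
  f = \sum_(g <- s) tcoef g f *: mono g.
Proof.
have [s fE] := twalg_comb f; exists (undup (unzip2 s)); rewrite ?undup_uniq //.
by rewrite fE -lincomb_collect.
Qed.
End TwistedGroupAlgebra.

(** * Zero divisors and the Ore condition *)

Section Domain.
Variables (K : fieldType) (G : zmodType) (c : bicharacter K G).

Lemma twalg_supp (f : twalg c) : exists s : seq G,
  [/\ uniq s, forall g, (g \in s) = (tcoef g f != 0)
    & f = \sum_(g <- s) tcoef g f *: mono c g].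
Proof.
have [s s_uniq fE] := twalg_tcoef f.
exists [seq g <- s | tcoef g f != 0]; split; first exact: filter_uniq.
- move=> g; rewrite mem_filter andb_idr // => fg; apply: contraNT fg => gs.
  rewrite fE tcoef_sum big_seq big1 //= => h hs.
  rewrite tcoefZ tcoef_mono; case: eqP => [gh|_]; last by rewrite mulr0.
  by rewrite gh hs in gs.
- rewrite big_filter {1}fE (bigID (fun g => tcoef g f == 0)) /= big1 ?add0r //.
  by move=> g /eqP->; rewrite scale0r.
Qed.

Lemma tcoefM_supp (f f' : twalg c) s s' g :
  f = \sum_(h <- s) tcoef h f *: mono c h ->
  f' = \sum_(h <- s') tcoef h f' *: mono c h ->
  tcoef g (f * f') = \sum_(h <- s) \sum_(h' <- s')
    tcoef h f * tcoef h' f' * (c h' h)^-1 * (g == h + h')%:R.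
Proof.
move=> fE f'E; rewrite {1}fE {1}f'E mulr_suml tcoef_sum; apply: eq_bigr => h _.
rewrite mulr_sumr tcoef_sum; apply: eq_bigr => h' _.
by rewrite -scalerAl -scalerAr monoM !tcoefZ tcoef_mono !mulrA.
Qed.

Variable pos : G -> Prop.
Hypothesis pos0 : ~ pos 0.
Hypothesis posD : forall g h, pos g -> pos h -> pos (g + h).
Hypothesis pos_total : forall g, g != 0 -> pos g \/ pos (- g).

Lemma pos_max (s : seq G) : s != [::] ->
  exists2 g, g \in s & forall h, h \in s -> h != g -> pos (g - h).
Proof.
elim: s => // g s IHs _; have [->|s0] := eqVneq s [::].
  by exists g; rewrite ?inE // => h; rewrite inE => /eqP->; rewrite eqxx.
have [g' g's g'max] := IHs s0; have [gg'|gg'] := eqVneq g g'.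
  exists g'; first by rewrite inE g's orbT.
  by move=> h; rewrite inE gg' => /predU1P[->|/g'max]//; rewrite eqxx.
have [gpos|] : pos (g - g') \/ pos (- (g - g')) by apply: pos_total; rewrite subr_eq0.
  exists g; first by rewrite inE eqxx.
  move=> h; rewrite inE => /predU1P[->|hs _]; first by rewrite eqxx.
  have [->//|/(g'max _ hs) hpos] := eqVneq h g'.
  by rewrite -(subrK g' g) -addrA; apply: posD.
rewrite opprB => gpos; exists g'; first by rewrite inE g's orbT.
by move=> h; rewrite inE => /predU1P[->//|]; apply: g'max.
Qed.

(** Here [pos] is the strictly positive cone of a total order on [G]. At the sum of the two leading
    exponents only the leading terms contribute: any other pair of exponents with that sum would
    make 0 positive. *)
Lemma twalg_domain (f f' : twalg c) : f != 0 -> f' != 0 -> f * f' != 0.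
Proof.
have supp0 (e : twalg c) s : e != 0 -> e = \sum_(g <- s) tcoef g e *: mono c g ->
    s != [::].
  by move=> e0 eE; apply: contraNneq e0 => s0; rewrite eE s0 big_nil.
move=> f0 f'0; have [s [s_uniq s_supp fE]] := twalg_supp f.
have [s' [s'_uniq s'_supp f'E]] := twalg_supp f'.
have [g gs gmax] := pos_max (supp0 _ _ f0 fE).
have [g' g's g'max] := pos_max (supp0 _ _ f'0 f'E).
suff: tcoef (g + g') (f * f') != 0 by apply: contraNneq => ->; rewrite tcoef0.
rewrite (tcoefM_supp _ fE f'E) (bigD1_seq g) //= (bigD1_seq g') //= eqxx mulr1.
rewrite !big1_seq ?addr0.
- apply: mulf_neq0; last by rewrite invr_eq0 bichar_neq0.
  by apply: mulf_neq0; rewrite -?s_supp -?s'_supp.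
- move=> h /andP[hg hs]; rewrite big1_seq // => h' /andP[_ h's].
  case: eqP => [ghE|_]; last by rewrite mulr0.
  have hpos := gmax _ hs hg; case: pos0.
  have -> : 0 = g - h + (g' - h') by rewrite addrACA -opprD ghE subrr.
  have [<-|h'g'] := eqVneq h' g'; first by rewrite subrr addr0.
  by apply: posD => //; apply: g'max.
- move=> h' /andP[h'g' h's]; case: eqP => [|_]; last by rewrite mulr0.
  by move=> /addrI gh; rewrite gh eqxx in h'g'.
Qed.
End Domain.

Section LexicographicCone.
Variable N : nat.
Implicit Types g h : 'rV[int]_N.

Definition lexpos g : Prop :=
  exists2 i : 'I_N, (forall j : 'I_N, (j < i)%N -> g 0 j = 0) & (0 < g 0 i)%R.

Lemma lexpos0 : ~ lexpos 0.
Proof. by case=> i _; rewrite mxE. Qed.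

Lemma lexposD g h : lexpos g -> lexpos h -> lexpos (g + h).
Proof.
case=> i gi0 gi [j hj0 hj]; have [ij|ji|ij] := ltngtP i j.
- exists i => [k ki|]; last by rewrite mxE hj0 // addr0.
  by rewrite mxE gi0 // hj0 ?addr0 // (ltn_trans ki).
- exists j => [k kj|]; last by rewrite mxE gi0 // add0r.
  by rewrite mxE hj0 // gi0 ?addr0 // (ltn_trans kj).
- have {}ij := val_inj ij; subst j; exists i => [k ki|].
    by rewrite mxE gi0 // hj0.
  by rewrite mxE; move: (g 0 i) (h 0 i) gi hj => a b; lia.
Qed.

Lemma lexpos_total g : g != 0 -> lexpos g \/ lexpos (- g).
Proof.
move=> /rV0Pn[i0 gi0]; case: (@arg_minnP _ i0 (fun i => g 0 i != 0) val gi0).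
move=> i gi imin; have z (j : 'I_N) : (j < i)%N -> g 0 j = 0.
  by move=> ji; apply/eqP; apply: contraLR ji => /imin; rewrite -leqNgt.
have [gpos|gneg] : (0 < g 0 i)%R \/ (0 < - g 0 i)%R by move: (g 0 i) gi => a; lia.
  by left; exists i.
by right; exists i => [j /z|]; rewrite mxE // => ->; rewrite oppr0.
Qed.
End LexicographicCone.

(** * The right Ore condition, by counting dimensions *)

Lemma lin_dep (K : fieldType) (V : lmodType K) (I J : finType)
    (v : I -> V) (w : J -> V) :
  (#|J| < #|I|)%N ->
  (forall i, exists a : J -> K, v i = \sum_j a j *: w j) ->
  exists2 a : I -> K, (exists i, a i != 0) & \sum_i a i *: v i = 0.
Proof.
move=> ltJI /boolp.choice[a vE].
pose A := \matrix_(i < #|I|, j < #|J|) a (enum_val i) (enum_val j).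
have /rowV0Pn[b bA b0] : kermx A != 0.
  by rewrite kermx_eq0 /row_free ltn_eqF // (leq_ltn_trans (rank_leq_col A)).
exists (fun i => b 0 (enum_rank i)).
  have [i bi] := rV0Pn b b0.
  by exists (enum_val i); rewrite enum_valK.
under eq_bigr => i _ do rewrite vE scaler_sumr.
rewrite exchange_big big1 //= => j _.
under eq_bigr => i _ do rewrite scalerA.
rewrite -scaler_suml; move/sub_kermxP/matrixP: bA => /(_ 0 (enum_rank j)).
rewrite !mxE (reindex enum_rank) /=; last exact/onW_bij/enum_rank_bij.
under eq_bigr => i _ do rewrite mxE !enum_rankK.
by move=> ->; rewrite scale0r.
Qed.

(** The auxiliary bound is the Bernoulli-type inequality (1 + 1/M)^j (1 - j/M) <= 1, cleared of
    denominators. At j = N the second factor exceeds 1/2. *)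
Lemma expn_succ_lt2 M N : (2 * N < M)%N -> (M.+1 ^ N < 2 * M ^ N)%N.
Proof.
move=> ltM; suff H j : (j <= N)%N -> (M.+1 ^ j * (M - j) <= M * M ^ j)%N.
  have := H N (leqnn _); set a := (M.+1 ^ N)%N; set b := (M ^ N)%N => le.
  have a0 : (0 < a)%N by rewrite expn_gt0.
  rewrite -(ltn_pmul2l (leq_ltn_trans (leq0n _) ltM)); nia.
elim: j => [|j IHj] jN; first by rewrite !expn0 subn0 mul1n muln1.
have {}IHj := IHj (ltnW jN); rewrite !expnS.
apply: (@leq_trans (M * (M.+1 ^ j * (M - j)))%N); last by rewrite leq_mul2l IHj orbT.
rewrite [(M.+1 * _)%N]mulnC -!mulnA [(M * (_ * _))%N]mulnCA leq_mul2l; apply/orP; right.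
nia.
Qed.

Section Ore.
Variables (K : fieldType) (N : nat) (c : bicharacter K 'rV[int]_N).

(** The exponents in a cube of side [n] with lowest corner (-k, ..., -k). Indexing by finite
    functions makes their number n^N a library fact. *)
Definition box n (k : nat) (e : {ffun 'I_N -> 'I_n}) : 'rV[int]_N :=
  \row_j ((e j)%:Z - k%:Z).

Lemma box_inj n k : injective (@box n k).
Proof.
move=> e e' /rowP ee'; apply/ffunP => j; apply: val_inj.
by have := ee' j; rewrite !mxE /=; lia.
Qed.

Lemma supp_bound (s : seq 'rV[int]_N) : exists k : nat,
  forall g, g \in s -> forall j, (`|g 0%R j| <= k)%N.
Proof.
elim: s => [|g s [k IHk]]; first by exists 0%N.
exists (maxn k (\max_j `|g 0%R j|)%N) => h; rewrite inE => /predU1P[->|hs] j.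
  by rewrite leq_max (@leq_bigmax 'I_N (fun j => `|g 0%R j|%N)) orbT.
by rewrite leq_max IHk.
Qed.

Lemma mul_mono_box (f : twalg c) k n (e : {ffun 'I_N -> 'I_n}) :
  (forall g, tcoef g f != 0 -> forall j, (`|g 0%R j| <= k)%N) ->
  exists a : {ffun 'I_N -> 'I_(n + k.*2)} -> K,
    f * mono c (box 0 e) = \sum_j a j *: mono c (box k j).
Proof.
move=> fk; have [s [_ s_supp fE]] := twalg_supp f.
rewrite fE mulr_suml big_seq.
apply: (big_ind (fun h => exists a : {ffun 'I_N -> 'I_(n + k.*2)} -> K,
  h = \sum_j a j *: mono c (box k j))).
- by exists (fun=> 0); rewrite big1 // => j _; rewrite scale0r.
- move=> _ _ [a ->] [b ->]; exists (fun j => a j + b j).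
  by rewrite -big_split; apply: eq_bigr => j _; rewrite scalerDl.
move=> g; rewrite s_supp => /fk gk.
(* Since [g 0 j] is at least -k, the number inside is nonnegative: the absolute value is only a cast
   to [nat]. *)
have lt_e' j : (`|(g 0%R j + (e j)%:Z + k%:Z)%R| < n + k.*2)%N.
  by have := gk j; have := ltn_ord (e j); lia.
pose e' := [ffun j => Ordinal (lt_e' j)].
have -> : tcoef g f *: mono c g * mono c (box 0 e) =
    (tcoef g f * (c (box 0 e) g)^-1) *: mono c (box k e').
  rewrite -scalerAl monoM scalerA; congr (_ *: mono c _).
  apply/rowP => j; rewrite !mxE ffunE /=.
  have shiftE (a : int) (b : nat) : (absz a <= k)%N ->
      a + (b%:Z - 0%:Z) = (absz (a + b%:Z + k%:Z))%:Z - k%:Z by lia.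
  exact: shiftE (gk j).
set b := tcoef g f * _; exists (fun j => b * (j == e')%:R).
rewrite (bigD1 e') //= eqxx mulr1 big1 ?addr0 // => j /negPf->.
by rewrite mulr0 scale0r.
Qed.

(* Counting monomials: multiplication by f and by f' sends the box of side n
   into a box of side n + 2k, and 2 n^N > (n + 2k)^N for large n. *)
Lemma twalg_ore (f f' : twalg c) : f != 0 -> f' != 0 ->
  exists r r' : twalg c, f * r = f' * r' /\ f * r != 0.
Proof.
move=> f0 f'0; have [k fk f'k] : exists2 k : nat,
    (forall g, tcoef g f != 0 -> forall j, (`|g 0%R j| <= k)%N) &
    (forall g, tcoef g f' != 0 -> forall j, (`|g 0%R j| <= k)%N).
  have [s [_ sE _]] := twalg_supp f; have [s' [_ s'E _]] := twalg_supp f'.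
  have [k kP] := supp_bound (s ++ s').
  by exists k => g; rewrite -?sE -?s'E => gs; apply: kP; rewrite mem_cat gs ?orbT.
have [n ltn2] : exists n, ((n + k.*2) ^ N < n ^ N + n ^ N)%N.
  (* With s = 2k + 2 and M = 2N + 1, n = sM gives n + 2k <= s(M + 1). The factor s^N then cancels,
     leaving (M + 1)^N < 2 M^N. *)
  exists (k.*2.+2 * (2 * N).+1)%N.
  have := expn_succ_lt2 (ltnSn (2 * N)); set M := (2 * N).+1 => ltM.
  have k0 : (0 < k.*2.+2 ^ N)%N by rewrite expn_gt0.
  apply: (@leq_ltn_trans ((k.*2.+2 * M.+1) ^ N)%N).
    have leX a b l : (a <= b)%N -> (a ^ l <= b ^ l)%N.
      by move=> ab; elim: l => // l; rewrite !expnS; apply: leq_mul.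
    by apply: leX; nia.
  by rewrite !expnMn; nia.
pose I := {ffun 'I_N -> 'I_n}.
pose v (i : I + I) := match i with
  inl e => f * mono c (box 0 e) | inr e => f' * mono c (box 0 e) end.
have [|i|a [i ai] av0] := @lin_dep _ _ _ {ffun 'I_N -> 'I_(n + k.*2)} v
    (fun j => mono c (box k j)).
- by rewrite card_sum !card_ffun !card_ord.
- by case: i => e; apply: mul_mono_box.
pose r := \sum_e a (inl e) *: mono c (box 0 e).
pose r' := \sum_e - a (inr e) *: mono c (box 0 e).
have frE : f * r = f' * r'.
  apply/eqP; rewrite -subr_eq0 -[X in _ == X]av0 big_sumType /= /r /r' !mulr_sumr -sumrN.
  apply/eqP; congr (_ + _); apply: eq_bigr => e _; first by rewrite scalerAr.
  by rewrite -scalerAr scaleNr opprK.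
have coef_lincomb (b : I -> K) e :
    tcoef (box 0 e) (\sum_e b e *: mono c (box 0 e)) = b e.
  rewrite tcoef_sum (bigD1 e) //= tcoefZ tcoef_mono eqxx big1 => [|e' e'e].
    by rewrite addr0 mulr1.
  by rewrite tcoefZ tcoef_mono (inj_eq (@box_inj _ _)) eq_sym (negPf e'e) mulr0.
have dom (h h' : twalg c) : h != 0 -> h' != 0 -> h * h' != 0.
  apply: (twalg_domain (pos := @lexpos N)); first exact: lexpos0.
    exact: lexposD.
  exact: lexpos_total.
(* The nonzero coefficient of the relation belongs to [r] or to [r']. Either way the common multiple
   is a product of two nonzero elements of a domain. *)
exists r, r'; split=> //; case: i ai => e ae.
- apply: dom => //; apply: contraNneq ae => r0.
  by have /= <- := coef_lincomb (fun e => a (inl e)) e; rewrite -/r r0 tcoef0.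
- rewrite frE; apply: dom => //; apply: contraNneq ae => r0.
  rewrite -oppr_eq0.
  by have /= <- := coef_lincomb (fun e => - a (inr e)) e; rewrite -/r' r0 tcoef0.
Qed.
End Ore.

(** * Goldie rank of matrix rings *)

Section MatrixGoldieRank.
Variables (D : nzRingType) (n : nat).
Hypothesis ore : forall f g : D, f != 0 -> g != 0 ->
  exists r r' : D, f * r = g * r' /\ f * r != 0.

Let S : nzRingType := 'M[D]_n.+1.
Let V : lmodType S^c := (S^c)^o.

Definition row_ideal (i : 'I_n.+1) : set V :=
  [set A | forall k l, k != i -> (A : S) k l = 0].

Lemma row_ideal_submodule i : is_submodule (row_ideal i).
Proof.
split=> [k l _|A B hA hB k l ki|B A hA k l ki]; rewrite mxE //.
  by rewrite hA // hB // addr0.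
by rewrite big1 // => j _; rewrite hA // mul0r.
Qed.

Lemma row_ideal_delta i (A : S) j r : row_ideal i A ->
  A * (r *: delta_mx j 0) = (A i j * r) *: delta_mx i 0.
Proof.
move=> hA; apply/matrixP => k l; rewrite !mxE (bigD1 j) //= !mxE eqxx /=.
rewrite big1 ?addr0 => [|k' /negPf k'j]; last by rewrite !mxE k'j mulr0 mulr0.
have [->|ki] := eqVneq k i; first by rewrite mulrA.
by rewrite hA // mul0r mulr0.
Qed.

Lemma submodule_neq0 (N : set V) : is_submodule N -> N <> [set 0] ->
  exists2 A, N A & A != 0.
Proof.
case=> N0 _ _ Nneq; apply: contrapT => none; apply: Nneq; apply/seteqP.
split=> [A NA|_ ->//]; apply: contrapT => /eqP A0; apply: none.
by exists A.
Qed.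

Lemma set_neq0 (N : set V) A : N A -> A != 0 -> N <> [set 0].
Proof. by move=> NA /eqP A0 NE; rewrite NE in NA. Qed.

(** Right multiplication by a multiple of a matrix unit isolates one nonzero entry of row [i] and
    carries it to column 0. The Ore multipliers make the entries obtained from two submodules
    agree. *)
Lemma row_ideal_uniform i : is_uniform (row_ideal i).
Proof.
split; first exact: row_ideal_submodule.
  apply: (@set_neq0 _ (delta_mx i 0 : S)) => [k l /negPf ki|].
    by rewrite mxE ki.
  apply/eqP => /matrixP/(_ i 0); rewrite !mxE !eqxx => /eqP.
  by rewrite oner_eq0.
move=> N N' sN sN' NU N'U /(submodule_neq0 sN)[A NA A0].
move=> /(submodule_neq0 sN')[B NB B0].
have nz (C : S) : row_ideal i C -> C != 0 -> exists j, C i j != 0.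
  move=> hC C0; apply: contrapT => none; move/eqP: C0; apply.
  apply/matrixP => k l; rewrite mxE; have [->|/hC//] := eqVneq k i.
  by apply: contrapT => /eqP Cil; apply: none; exists l.
have [j Aij] := nz _ (NU _ NA) A0; have [j' Bij] := nz _ (N'U _ NB) B0.
have [r [r' [rE r0]]] := ore Aij Bij.
case: sN sN' => _ _ sN [_ _ sN'].
apply: (@set_neq0 _ ((A : S) i j * r *: delta_mx i 0 : S)).
  split; first by rewrite -row_ideal_delta; [apply: sN|apply: NU].
  by rewrite rE -row_ideal_delta; [apply: sN'|apply: N'U].
apply/eqP => /matrixP/(_ i 0); rewrite !mxE !eqxx mulr1 => /eqP.
by rewrite (negPf r0).
Qed.

Lemma matrix_right_goldie_rank : has_right_goldie_rank S n.+1.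
Proof.
exists row_ideal; split; first exact: row_ideal_uniform.
  move=> A hA /matrixP sA0 i; apply/matrixP => k l; rewrite mxE.
  have [->|/(hA i)//] := eqVneq k i; move: (sA0 i l).
  rewrite summxE (bigD1 i) //= big1 ?addr0 ?mxE // => j ji.
  by rewrite hA // eq_sym.
have -> : sum_submod row_ideal = setT.
  apply/seteqP; split=> // A _.
  exists (fun i => \matrix_(k, l) ((A : S) k l *+ (k == i)) : S).
    by move=> i k l /negPf ki; rewrite mxE ki.
  apply/matrixP => k l; rewrite summxE (bigD1 k) //= mxE eqxx big1 ?addr0 //.
  by move=> i ik; rewrite mxE eq_sym (negPf ik).
split=> [|N _]; first by split.
by rewrite setTI.
Qed.
End MatrixGoldieRank.

(** * The quantum torus modulo z_p - t *)

Section GeneratedSubalgebra.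
Variables (K : fieldType) (A : algType K) (Q : A -> Prop).
Hypothesis Q1 : Q 1.
Hypothesis QD : forall a b, Q a -> Q b -> Q (a + b).
Hypothesis QZ : forall k a, Q a -> Q (k *: a).
Hypothesis QM : forall a b, Q a -> Q b -> Q (a * b).

Let P : pred A := [pred a | `[< Q a >]].

Fact subalgebra_closed : GRing.subsemialg_closed P.
Proof.
have Q0 : Q 0 by rewrite -(scale0r 1); apply: QZ.
apply: GRing.subalg_closed_semi; split.
- by apply/asboolP.
- move=> k a b /asboolP Qa /asboolP Qb.
  by apply/asboolP/QD => //; apply: QZ.
- by move=> a b /asboolP Qa /asboolP Qb; apply/asboolP/QM.
Qed.
HB.instance Definition _ := GRing.isSubalgClosed.Build K A P subalgebra_closed.

Definition subalgebra := {a : A | P a}.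
HB.instance Definition _ := SubChoice.on subalgebra.
HB.instance Definition _ := [SubChoice_isSubAlgebra of subalgebra by <:].

(** The universal property sends [A] into the subalgebra cut out by [Q]. Followed by the inclusion,
    this is an endomorphism fixing the generators, hence the identity by uniqueness. *)
Lemma subalgebra_torus_eq p q (z zV : nat -> A) : is_quantum_torus p q z zV ->
  (forall i, (1 <= i <= p)%N -> Q (z i) /\ Q (zV i)) -> forall a, Q a.
Proof.
move=> [[zK zC] univ] Qz a.
have valM (x y : subalgebra) : val (x * y) = val x * val y by [].
have val1 : val (1 : subalgebra) = 1 by [].
have valZ k (x : subalgebra) : val (k *: x) = k *: val x by [].
pose b i : subalgebra := insubd 0 (z i).
pose bV i : subalgebra := insubd 0 (zV i).
have valb i : (1 <= i <= p)%N -> val (b i) = z i.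
  by move=> /Qz[Qzi _]; rewrite insubdK // unfold_in; apply/asboolP.
have valbV i : (1 <= i <= p)%N -> val (bV i) = zV i.
  by move=> /Qz[_ Qzi]; rewrite insubdK // unfold_in; apply/asboolP.
have [|g [gz _]] := univ subalgebra b bV.
  split=> [i ip|i j ji ip].
    by have [zi zVi] := zK i ip; split; apply/val_inj; rewrite valM val1 valb ?valbV.
  have jp : (1 <= j <= p)%N by lia.
  have {}ip : (1 <= i <= p)%N by lia.
  by apply/val_inj; rewrite valZ !valM !valb // zC //; lia.
have [g0 [_ uniq_g0]] := univ A z zV (conj zK zC).
have vg_linear : linear (fun x => val (g x)).
  by move=> k x y; rewrite linearP.
have vg_monoid : monoid_morphism (fun x => val (g x)).
  by split=> [|x y]; rewrite ?rmorph1 ?rmorphM.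
pose vg : {lrmorphism A -> A} := HB.pack (fun x => val (g x))
  (GRing.isLinear.Build K A A *:%R _ vg_linear)
  (GRing.isMonoidMorphism.Build A A _ vg_monoid).
have -> : a = val (g a).
  rewrite -[RHS]/(vg a) uniq_g0 => [|i ip]; last by rewrite /= gz ?valb.
  by rewrite -[LHS]/((idfun : {lrmorphism A -> A}) a) uniq_g0.
exact/asboolP/(valP (g a)).
Qed.
End GeneratedSubalgebra.

Section TorusInduction.
Variables (K : fieldType) (p : nat) (q : K) (A : algType K) (z zV : nat -> A).
Hypothesis A_torus : is_quantum_torus p q z zV.

Lemma torus_ind (Q : A -> Prop) :
  Q 1 -> (forall a b, Q a -> Q b -> Q (a + b)) ->
  (forall k a, Q a -> Q (k *: a)) ->
  (forall i a, (1 <= i <= p)%N -> Q a -> Q (z i * a) /\ Q (zV i * a)) ->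
  forall a, Q a.
Proof.
move=> Q1 QD QZ Qz a; rewrite -[a]mulr1.
(* [Q] need not be closed under products, but the set of all [a] such that left multiplication by
   [a] preserves [Q] is. *)
apply: (subalgebra_torus_eq (Q := fun a => forall b, Q b -> Q (a * b)) _ _ _ _
  A_torus) => //.
- by move=> b; rewrite mul1r.
- by move=> b b' Qb Qb' c Qc; rewrite mulrDl; apply: QD; auto.
- by move=> k b Qb c Qc; rewrite -scalerAl; apply: QZ; auto.
- by move=> b b' Qb Qb' c Qc; rewrite -mulrA; auto.
- by move=> i ip; split=> b /(Qz _ _ ip)[].
Qed.
End TorusInduction.

Section ScalarCommutation.
Variables (K : fieldType) (A : algType K).

Definition scomm (a b : A) := exists2 s : K, s != 0 & a * b = s *: (b * a).

Lemma scomm_sym a b : scomm a b -> scomm b a.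
Proof.
case=> s s0 ab; exists s^-1; first by rewrite invr_eq0.
by rewrite ab scalerA mulVf ?scale1r.
Qed.

Lemma scomm1 a : scomm a 1.
Proof. by exists 1; rewrite ?oner_neq0 // mulr1 mul1r scale1r. Qed.

Lemma scommM a b b' : scomm a b -> scomm a b' -> scomm a (b * b').
Proof.
case=> s s0 ab [s' s'0 ab']; exists (s * s'); first by rewrite mulf_neq0.
by rewrite mulrA ab -scalerAl -(mulrA b a) ab' -scalerAr scalerA mulrA.
Qed.

Lemma scommX a b n : scomm a b -> scomm a (b ^+ n).
Proof.
by move=> ab; elim: n => [|n IHn]; [apply: scomm1|rewrite exprS; apply: scommM].
Qed.

Lemma scommV a b bV : b * bV = 1 -> bV * b = 1 -> scomm a b -> scomm a bV.
Proof.
move=> bbV bVb [s s0 ab]; exists s^-1; first by rewrite invr_eq0.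
rewrite -[a in LHS]mul1r -bVb -(mulrA bV) -[b * a](scalerK s0) -ab.
by rewrite -scalerAr -scalerAl -!mulrA bbV mulr1.
Qed.
End ScalarCommutation.

Section QuantumTorusQuotient.
Variables (K : fieldType) (p : nat) (q : K) (A : algType K) (z zV : nat -> A).
Hypotheses (p_odd : odd p) (q_neq0 : q != 0).
Hypothesis A_torus : is_quantum_torus p q z zV.
Variable t : K.
Hypothesis t_neq0 : t != 0.

Let N := p.-1.
Let p_gt0 : (0 < p)%N. Proof. by case: p p_odd. Qed.

(** Putting 1 on and above the diagonal places the whole commutation factor in one of the two
    orders: for j < i, the two products of basis elements of degrees [expo i] and [expo j] differ
    exactly by [qcoef q i j]. *)
Definition kappa (i j : nat) : K := if (j < i)%N then qcoef q i j else 1.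

Lemma kappa_neq0 i j : kappa i j != 0.
Proof. by rewrite /kappa /qcoef; do 2?case: ifP; rewrite ?invr_eq0 ?oner_neq0. Qed.

Definition torus_bichar (g h : 'rV[int]_N) : K :=
  \prod_(i < N) \prod_(j < N) kappa i.+1 j.+1 ^ (g 0 i * h 0 j).

Fact torus_bichar_neq0 g h : torus_bichar g h != 0.
Proof.
by do 2![rewrite prodf_seq_neq0; apply/allP => ? _ /=]; rewrite expfz_neq0 ?kappa_neq0.
Qed.

Fact torus_bicharDl g g' h :
  torus_bichar (g + g') h = torus_bichar g h * torus_bichar g' h.
Proof.
rewrite -big_split; apply: eq_bigr => i _; rewrite -big_split.
by apply: eq_bigr => j _; rewrite mxE mulrDl expfzDr ?kappa_neq0.
Qed.

Fact torus_bicharDr g h h' :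
  torus_bichar g (h + h') = torus_bichar g h * torus_bichar g h'.
Proof.
rewrite -big_split; apply: eq_bigr => i _; rewrite -big_split.
by apply: eq_bigr => j _; rewrite mxE mulrDr expfzDr ?kappa_neq0.
Qed.

Definition torus_c := Bicharacter torus_bichar_neq0 torus_bicharDl torus_bicharDr.
Let D := twalg torus_c.
Let T g : D := mono torus_c g.

(* [expo p] is zero, so that z_p can be sent to the scalar t *)
Definition expo (i : nat) : 'rV[int]_N := \row_j (j.+1 == i)%:Z.

Lemma expo_p : expo p = 0.
Proof.
apply/rowP => j; rewrite !mxE; case: eqP => // jp.
by have jN : (j < p.-1)%N := ltn_ord j; lia.
Qed.

(** The index [p] is included although [expo p] is zero. This is consistent because [p] is odd and
    maximal, so all commutation factors of [z_p] are 1. *)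
Lemma torus_c_expo i j : (1 <= i <= p)%N -> (1 <= j <= p)%N ->
  torus_c (expo i) (expo j) = kappa i j.
Proof.
move=> ip jp; have [->|/eqP i'p] := eqVneq i p.
  rewrite expo_p bichar0l /kappa /qcoef p_odd /=; by case: ifP.
have [->|/eqP j'p] := eqVneq j p.
  rewrite expo_p /= /torus_bichar big1 => [|k _].
    by rewrite /kappa; case: ifP => //; lia.
  by rewrite big1 // => l _; rewrite !mxE mulr0 expr0z.
have iN : (i.-1 < N)%N by rewrite /N; lia.
have jN : (j.-1 < N)%N by rewrite /N; lia.
rewrite /= /torus_bichar (bigD1 (Ordinal iN)) //= (bigD1 (Ordinal jN)) //= !mxE /=.
rewrite !prednK ?eqxx ?expr1z; try lia.
rewrite !big1 ?mulr1 // => [k ki|l lj].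
  rewrite big1 // => l _; rewrite !mxE; case: eqP => [kE|_]; last by rewrite mul0r expr0z.
  by case/eqP: ki; apply: val_inj => /=; lia.
rewrite !mxE; case: eqP => [lE|_]; last by rewrite mulr0 expr0z.
by case/eqP: lj; apply: val_inj => /=; lia.
Qed.

Let sc i : K := if i == p then t else 1.
Let sc_neq0 i : sc i != 0. Proof. by rewrite /sc; case: ifP; rewrite ?oner_neq0. Qed.

Lemma monoK g : T g * ((torus_c (- g) g) *: T (- g)) = 1.
Proof. by rewrite -scalerAr monoM scalerA divff ?bichar_neq0 // scale1r subrr. Qed.

Lemma monoVK g : (torus_c (- g) g) *: T (- g) * T g = 1.
Proof.
have bicharNl : torus_c (- g) g = torus_c g (- g).
  apply: (mulfI (bichar_neq0 torus_c g g)); rewrite -bicharDl subrr bichar0l.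
  by rewrite bicharNr divff ?bichar_neq0.
by rewrite -scalerAl monoM scalerA bicharNl divff ?bichar_neq0 // scale1r addNr.
Qed.

Let bz i : D := sc i *: T (expo i).
Let bzV i : D := (sc i)^-1 *: (torus_c (- expo i) (expo i) *: T (- expo i)).

Lemma torus_quotient_relations : torus_relations p q bz bzV.
Proof.
split=> [i ip|i j ji ip]; rewrite /bz /bzV.
  by split; rewrite -scalerAl -scalerAr ?monoK ?monoVK scalerA
    ?divff ?mulVf ?sc_neq0 // scale1r.
rewrite -!scalerAl -!scalerAr !monoM !torus_c_expo; try lia.
rewrite !scalerA addrC; congr (_ *: _); rewrite /kappa.
have -> : (i < j)%N = false by lia.
have -> : (j < i)%N by lia.
have qc0 : qcoef q i j != 0.
  by rewrite /qcoef; case: ifP; rewrite ?invr_eq0 ?oner_neq0.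
by rewrite divr1; field.
Qed.


Variable pi : {lrmorphism A -> D}.
Hypothesis pi_z : forall i, (1 <= i <= p)%N -> pi (z i) = bz i.

Let piM a b : pi (a * b) = pi a * pi b. Proof. exact: rmorphM. Qed.
Let piD a b : pi (a + b) = pi a + pi b. Proof. exact: raddfD. Qed.
Let piZ k a : pi (k *: a) = k *: pi a. Proof. exact: linearZ. Qed.
Let pi_sum (I : Type) (s : seq I) (F : I -> A) :
  pi (\sum_(i <- s) F i) = \sum_(i <- s) pi (F i).
Proof. exact: raddf_sum. Qed.
Let pi1 : pi 1 = 1. Proof. exact: rmorph1. Qed.

Lemma pi_zV i : (1 <= i <= p)%N -> pi (zV i) = bzV i.
Proof.
move=> ip; have [zK _] := A_torus.1.1 i ip.
have [_ bVb] := torus_quotient_relations.1 i ip.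
by rewrite -[LHS]mul1r -bVb -mulrA -pi_z // -piM zK pi1 mulr1.
Qed.

Definition pow (i : nat) (k : int) : A :=
  match k with Posz n => z i ^+ n | Negz n => zV i ^+ n.+1 end.

Definition monomial (g : 'rV[int]_N) : A := \prod_(j < N) pow j.+1 (g 0 j).

Let over (a : A) (g : 'rV[int]_N) := exists2 s : K, s != 0 & pi a = s *: T g.

Let over1 : over 1 0.
Proof. by exists 1; rewrite ?oner_neq0 // pi1 scale1r. Qed.

Let overM a b g h : over a g -> over b h -> over (a * b) (g + h).
Proof.
case=> s s0 pa [s' s'0 pb]; exists (s * s' * (torus_c h g)^-1).
  by rewrite !mulf_neq0 ?invr_eq0 ?bichar_neq0.
by rewrite piM pa pb -scalerAl -scalerAr monoM !scalerA.
Qed.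

Let overX a g n : over a g -> over (a ^+ n) (g *+ n).
Proof.
by move=> ag; elim: n => [|n IHn]; rewrite ?mulr0n // exprS mulrS; apply: overM.
Qed.

Lemma monomial_over g : over (monomial g) g.
Proof.
have {2}-> : g = \sum_(j < N) expo j.+1 *~ g 0 j.
  apply/rowP => k; rewrite summxE (bigD1 k) //= big1 ?addr0 => [|j jk].
    by case: (g 0 k) => n; rewrite /intmul ?mxE ?mulmxnE !mxE eqxx /=; lia.
  case: (g 0 j) => n; rewrite /intmul ?mxE mulmxnE mxE eqSS;
  by rewrite (inj_eq val_inj) eq_sym (negPf jk) mul0rn ?oppr0.
rewrite /monomial; apply: (big_ind2 over over1) => [a h b k|j _]; first exact: overM.
have jp : (1 <= j.+1 <= p)%N by have jN : (j < p.-1)%N := ltn_ord j; lia.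
have scj : sc j.+1 = 1.
  by rewrite /sc; case: eqP => // jp'; have jN : (j < p.-1)%N := ltn_ord j; lia.
case: (g 0 j) => n; rewrite /pow /intmul ?NegzE.
  by apply: overX; exists 1; rewrite ?oner_neq0 // pi_z // /bz scj.
rewrite -mulNrn; apply: overX.
exists (torus_c (- expo j.+1) (expo j.+1)); first exact: bichar_neq0.
by rewrite pi_zV // /bzV scj invr1 scale1r.
Qed.

Lemma scomm_z i j : (1 <= i <= p)%N -> (1 <= j <= p)%N -> scomm (z i) (z j).
Proof.
have [_ zC] := A_torus.1.
have lt k l : (1 <= k <= p)%N -> (1 <= l <= p)%N -> (l < k)%N -> scomm (z k) (z l).
  move=> kp lp lk; exists (qcoef q k l); last by apply: zC; lia.
  by rewrite /qcoef; case: ifP; rewrite ?invr_eq0 ?oner_neq0.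
move=> ip jp; have [ij|ji|->] := ltngtP i j.
- by apply/scomm_sym/lt.
- exact: lt.
- by exists 1; rewrite ?oner_neq0 // scale1r.
Qed.

Lemma scomm_pow i a j k : (1 <= i <= p)%N -> (1 <= j <= p)%N ->
  a = z i \/ a = zV i -> scomm a (pow j k).
Proof.
move=> ip jp aE; have [[zK zVK] [zK' zVK']] := (A_torus.1.1 i ip, A_torus.1.1 j jp).
have az : scomm a (z j).
  case: aE => ->; first exact: scomm_z.
  by apply/scomm_sym/(scommV zK zVK)/scomm_z.
by case: k => n; apply: scommX => //; apply: scommV az.
Qed.

Lemma pow_shift b i k : (1 <= i <= p)%N ->
  (if b then z i else zV i) * pow i k = pow i (k + (if b then 1 else -1)).
Proof.
move=> ip; have [zK zVK] := A_torus.1.1 i ip; case: b; case: k => [n|n]; rewrite {1}/pow.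
- have -> : Posz n + 1 = n.+1 by lia.
  by rewrite -exprS.
- case: n => [|n]; first by rewrite expr1 zK.
  have -> : Negz n.+1 + 1 = Negz n by lia.
  by rewrite exprS mulrA zK mul1r.
- case: n => [|n]; first by rewrite mulr1.
  have -> : Posz n.+1 - 1 = n by lia.
  by rewrite exprS mulrA zVK mul1r.
- have -> : Negz n - 1 = Negz n.+1 by lia.
  by rewrite -exprS.
Qed.

(** The new letter passes the factors of smaller index at the cost of a scalar and then merges with
    the factor of index [i]. *)
Lemma monomial_shift i b g : (1 <= i < p)%N ->
  exists s g', (if b then z i else zV i) * monomial g = s *: monomial g'.
Proof.
set a := (if b then _ else _) => ip; have iN : (i.-1 < N)%N by rewrite /N; lia.
have aE : a = z i \/ a = zV i by rewrite /a; case: (b); [left|right].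
pose i' := Ordinal iN; pose g' := g + (if b then expo i else - expo i).
have g'E j : j != i' -> g' 0 j = g 0 j.
  move=> ji; rewrite /g' mxE; suff -> : (if b then expo i else - expo i) 0 j = 0.
    by rewrite addr0.
  have ij : (j.+1 == i) = false.
    by apply: contraNF ji => /eqP ij; apply/eqP/val_inj => /=; lia.
  by case: (b); rewrite !mxE ij ?oppr0.
have i'E : i'.+1 = i by rewrite /=; lia.
have uniq_r : uniq (index_enum 'I_N) by exact: index_enum_uniq.
have : i' \in index_enum 'I_N by exact: mem_index_enum.
rewrite /monomial; case/splitPr rE: _ / => [r1 r2].
move: uniq_r; rewrite rE cat_uniq /= negb_or => /and3P[_ /andP[i'r1 _] /andP[i'r2 _]].
have bigE r : i' \notin r ->
    \prod_(j <- r) pow j.+1 (g' 0 j) = \prod_(j <- r) pow j.+1 (g 0 j).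
  move=> i'r; rewrite !big_seq; apply: eq_bigr => j jr; rewrite g'E //.
  by apply: contraNneq i'r => <-.
have [s _ ar] : scomm a (\prod_(j <- r1) pow j.+1 (g 0 j)).
  apply: big_ind => [|x y|j _]; [exact: scomm1|exact: scommM|].
  have jN : (j < p.-1)%N := ltn_ord j.
  by apply: (@scomm_pow i) => //; lia.
exists s, g'; rewrite !big_cat !big_cons !bigE // mulrA ar -scalerAl -!mulrA.
congr (_ *: (_ * _)); rewrite mulrA i'E pow_shift; last by lia.
congr (pow _ _ * _); rewrite /g' mxE; congr (_ + _).
by case: (b); rewrite !mxE i'E eqxx.
Qed.

(** An ordered monomial maps to [T g] only up to a nonzero scalar. Dividing by it gives exact lifts
    of the basis of [D]. *)
Lemma normal_monomials : exists zn : 'rV[int]_N -> A,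
  [/\ forall g, pi (zn g) = T g, exists s, 1 = s *: zn 0
    & forall i b g, (1 <= i < p)%N ->
        exists s g', (if b then z i else zV i) * zn g = s *: zn g'].
Proof.
have /choice[s sP] g : exists s : K, s != 0 /\ pi (monomial g) = s *: T g.
  by have [s s0 sE] := monomial_over g; exists s.
have mE g : monomial g = s g *: ((s g)^-1 *: monomial g).
  by rewrite scalerA divff ?scale1r //; case: (sP g).
exists (fun g => (s g)^-1 *: monomial g); split=> [g||i b g ip].
- by have [s0 sE] := sP g; rewrite piZ sE scalerA mulVf // scale1r.
- exists (s 0); rewrite -mE /monomial big1 // => j _.
  by rewrite mxE.
- have [s' [g' aE]] := monomial_shift b g ip.
  exists ((s g)^-1 * s' * s g'), g'.
  by rewrite -scalerAr aE -[RHS]scalerA -mE scalerA.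
Qed.

Let zt : A := z p - t%:A.

Lemma central_zt i (b : bool) a : (1 <= i <= p)%N ->
  (if b then z i else zV i) * (zt * a) = zt * ((if b then z i else zV i) * a).
Proof.
move=> ip; have [zK zVK] := A_torus.1.1 i ip.
have ziC : z i * z p = z p * z i.
  have [->//|/eqP i'p] := eqVneq i p.
  by rewrite [RHS]A_torus.1.2 /qcoef ?p_odd ?scale1r //; lia.
have zVC : zV i * z p = z p * zV i.
  by rewrite -[zV i * _]mulr1 -zK mulrA -(mulrA (zV i)) -ziC mulrA zVK mul1r.
rewrite !mulrA; congr (_ * _); rewrite /zt mulrBr mulrBl mulr_algl mulr_algr.
by case: b; rewrite ?ziC ?zVC.
Qed.

(** Since [zt] commutes with the generators, its multiples absorb left multiplication by them.
    Modulo these multiples [z p] acts as the scalar [t], so only the letters of index below [p]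
    matter. *)
Lemma torus_normal_form (zn : 'rV[int]_N -> A) :
  (exists s, 1 = s *: zn 0) ->
  (forall i b g, (1 <= i < p)%N ->
     exists s g', (if b then z i else zV i) * zn g = s *: zn g') ->
  forall a, exists (s : seq (K * 'rV[int]_N)) b,
    a = \sum_(x <- s) x.1 *: zn x.2 + zt * b.
Proof.
move=> zn1 znM; pose Q a := exists (s : seq (K * 'rV[int]_N)) b,
    a = \sum_(x <- s) x.1 *: zn x.2 + zt * b.
have QD a a' : Q a -> Q a' -> Q (a + a').
  case=> s [b ->] [s' [b' ->]]; exists (s ++ s'), (b + b').
  by rewrite big_cat mulrDr /= addrACA.
have QZ k a : Q a -> Q (k *: a).
  case=> s [b ->]; exists [seq (k * x.1, x.2) | x <- s], (k *: b).
  rewrite big_map scalerDr scaler_sumr scalerAr; congr (_ + _).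
  by apply: eq_bigr => x _; rewrite scalerA.
have Qzn g : Q (zn g).
  by exists [:: (1, g)], 0; rewrite big_seq1 scale1r mulr0 addr0.
have Qzt b : Q (zt * b) by exists [::], b; rewrite big_nil add0r.
have Q1 : Q 1 by case: zn1 => s ->; apply: QZ.
have Qz i (b : bool) a : (1 <= i <= p)%N -> Q a -> Q ((if b then z i else zV i) * a).
  move=> ip [s [a' ->]]; rewrite mulrDr central_zt //; apply: (QD _ _ _ (Qzt _)).
  rewrite mulr_sumr; apply: (big_ind Q) => [||x _]; [by rewrite -(mulr0 zt)|exact: (QD)|].
  rewrite -scalerAr; apply: (QZ); have [iE|/eqP i'p] := eqVneq i p; last first.
    have [|s' [g' ->]] := znM i b x.2; first by lia.
    exact: (QZ).
  have [zK zVK] := A_torus.1.1 i ip; case: b; rewrite iE in zK zVK *.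
    rewrite -[z p](subrK t%:A) mulrDl -scalerAl mul1r; apply: (QD) => //.
    exact: (QZ).
  (* This is the identity z_p^-1 = t^-1 - t^-1 (z_p - t) z_p^-1. *)
  have -> : zV p * zn x.2 = t^-1 *: zn x.2 + - t^-1 *: (zt * (zV p * zn x.2)).
    rewrite /zt !mulrA mulrBl zK -scalerAl mul1r mulrBl mul1r scalerBr !scaleNr.
    by rewrite opprK addrA subrr add0r -scalerAl scalerA mulVf // scale1r.
  by apply: (QD); apply: (QZ).
move=> a; apply: (torus_ind A_torus Q1 QD QZ) => i b ip Qb.
by split; [apply: (Qz i true)|apply: (Qz i false)].
Qed.

(** If [pi a] vanishes, the normal form of [a] maps to a zero combination of the independent [T g].
    Its monomial part is therefore zero and only the multiple of [zt] remains. *)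
Lemma torus_quotient_kernel a : pi a = 0 <-> right_multiples zt a.
Proof.
have pi_zt : pi zt = 0.
  have pp : (1 <= p <= p)%N by rewrite p_gt0 leqnn.
  have -> : zt = z p + (- t) *: 1 by rewrite /zt scaleNr.
  by rewrite piD piZ pi1 pi_z // /bz expo_p /sc eqxx scaleNr subrr.
split=> [pa0|[b _ <-]]; last by rewrite piM pi_zt mul0r.
have [zn [pi_zn zn1 znM]] := normal_monomials.
have [s [b aE]] := torus_normal_form zn1 znM a.
have sT0 : \sum_(x <- s) x.1 *: T x.2 = 0.
  rewrite -[RHS]pa0 aE piD piM pi_zt mul0r addr0 pi_sum.
  by apply: eq_bigr => x _; rewrite piZ pi_zn.
exists b => //; rewrite aE (lincomb_collect torus_c) sT0 big1 ?add0r // => g _.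
by rewrite tcoef0 scale0r.
Qed.

Lemma torus_quotient_surj (f : D) : exists a, pi a = f.
Proof.
have [s ->] := twalg_comb f; have [zn [pi_zn _ _]] := normal_monomials.
exists (\sum_(x <- s) x.1 *: zn x.2); rewrite pi_sum.
by apply: eq_bigr => x _; rewrite piZ pi_zn.
Qed.
End QuantumTorusQuotient.

Lemma torus_quotient (K : fieldType) p (q : K) (A : algType K) (z zV : nat -> A)
    (t : K) : odd p -> q != 0 -> is_quantum_torus p q z zV -> t != 0 ->
  exists (D : algType K) (pi : {lrmorphism A -> D}),
    [/\ forall f, exists a, pi a = f,
        forall a, pi a = 0 <-> right_multiples (z p - t%:A) a
      & forall f g : D, f != 0 -> g != 0 ->
          exists r r' : D, f * r = g * r' /\ f * r != 0].
Proof.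
move=> p_odd q0 A_torus t0.
have [pi [pi_z _]] := A_torus.2 _ _ _ (torus_quotient_relations p_odd q0 t0).
exists (twalg (torus_c p q0)), pi; split.
- exact: (torus_quotient_surj p_odd A_torus t0 pi_z).
- exact: (torus_quotient_kernel p_odd A_torus t0 pi_z).
- exact: twalg_ore.
Qed.

(** * Generalized Weyl algebras and the matrix representation *)

Section WeylNormalForm.
Variables (A W : nzRingType) (alpha alphaV : {rmorphism A -> A}) (w : A).
Variables (iota : {rmorphism A -> W}) (X Y : W).
Hypothesis W_rel : gwa_relations alpha alphaV w iota X Y.

Definition normal_form (r : W) := exists (n : nat) (a b : nat -> A),
  r = \sum_(0 <= i < n) iota (a i) * Y ^+ i + \sum_(1 <= i < n) iota (b i) * X ^+ i.

Lemma normal_form_pad (a : nat -> A) Z m n n' : (n <= n')%N ->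
  \sum_(m <= i < n) iota (a i) * Z ^+ i =
  \sum_(m <= i < n') iota (if (i < n)%N then a i else 0) * Z ^+ i.
Proof.
move=> nn'; rewrite (big_nat_widen _ _ _ _ _ nn') big_mkcond /=.
by apply: eq_bigr => i _; case: ifP; rewrite ?rmorph0 ?mul0r.
Qed.

Lemma normal_formD r r' : normal_form r -> normal_form r' -> normal_form (r + r').
Proof.
case=> n [a [b ->]] [n' [a' [b' ->]]]; pose l := maxn n n'.
exists l, (fun i => (if (i < n)%N then a i else 0) + (if (i < n')%N then a' i else 0)),
  (fun i => (if (i < n)%N then b i else 0) + (if (i < n')%N then b' i else 0)).
do 2!rewrite (normal_form_pad _ _ _ (leq_maxl n n')).
do 2!rewrite (normal_form_pad _ _ _ (leq_maxr n n')).
rewrite addrACA -!big_split.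
by congr (_ + _); apply: eq_bigr => i _; rewrite rmorphD mulrDl.
Qed.

Lemma normal_formY a i : normal_form (iota a * Y ^+ i).
Proof.
exists i.+1, (fun j => if j == i then a else 0), (fun=> 0).
rewrite big_nat_recr //= eqxx big_nat big1 => [|j /andP[_ ji]]; last first.
  by rewrite (ltn_eqF ji) rmorph0 mul0r.
by rewrite big1 ?add0r ?addr0 // => j _; rewrite rmorph0 mul0r.
Qed.

Lemma normal_formX a i : normal_form (iota a * X ^+ i).
Proof.
case: i => [|i]; first by have := normal_formY a 0; rewrite !expr0.
exists i.+2, (fun=> 0), (fun j => if j == i.+1 then a else 0).
rewrite [X in _ = _ + X]big_nat_recr //= eqxx [X in _ + (X + _)]big_nat.
rewrite ![X in _ = X + _]big1 => [|j _]; last by rewrite rmorph0 mul0r.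
rewrite big1 ?add0r // => j /andP[_ ji].
by rewrite (ltn_eqF ji) rmorph0 mul0r.
Qed.

Lemma powY_comm i a : Y ^+ i * iota a = iota (iter i alpha a) * Y ^+ i.
Proof.
have [_ _ YC _] := W_rel; elim: i => [|i IHi]; first by rewrite mul1r mulr1.
by rewrite exprS -mulrA IHi mulrA YC -mulrA.
Qed.

Lemma powYX i : exists c, Y ^+ i * X ^+ i = iota c.
Proof.
have [YX _ _ _] := W_rel; elim: i => [|i [c IHi]].
  by exists 1; rewrite mul1r rmorph1.
exists (iter i alpha (alpha w) * c).
rewrite exprSr exprS mulrA -(mulrA (Y ^+ i)) YX powY_comm -mulrA IHi.
by rewrite rmorphM.
Qed.

(** The inner product of equal powers of [Y] and [X] lies in [A], so min(i, j) letters of each kind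
    cancel and one kind survives. *)
Lemma normal_formYX a i j : normal_form (iota a * Y ^+ i * X ^+ j).
Proof.
have [ij|/ltnW ji] := leqP i j.
  have [c cE] := powYX i.
  rewrite -(subnKC ij) exprD mulrA -(mulrA (iota a)) cE.
  by have := normal_formX (a * c) (j - i); rewrite rmorphM.
have [c cE] := powYX j.
rewrite -(subnK ji) exprD mulrA -mulrA cE -mulrA powY_comm mulrA.
by have := normal_formY (a * iter (i - j) alpha c) (i - j); rewrite rmorphM.
Qed.
End WeylNormalForm.

Lemma skew_poly_ind (B S : nzRingType) (sigma : {rmorphism B -> B}) delta
    (iota : {rmorphism B -> S}) x (Q : S -> Prop) :
  is_skew_poly sigma delta iota x -> Q 0 ->
  (forall a b, Q a -> Q b -> Q (a + b)) ->
  (forall b i, Q (iota b * x ^+ i)) -> forall s, Q s.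
Proof.
move=> S_skew Q0 QD Qx s; have [P [-> _]] := skew_free S_skew s.
rewrite horner_coef; apply: big_ind => // i _.
by rewrite coef_map; apply: Qx.
Qed.

(** Expanding first in powers of [x], then in powers of [y], writes an element of [R] as a sum of
    terms a y^l x^i. Their images are handled by [normal_formYX]. *)
Lemma ambiskew_normal_form (A R W : nzRingType) (alpha alphaV : {rmorphism A -> A})
    (v w : A) (iotaR : {rmorphism A -> R}) (x y : R)
    (iotaW : {rmorphism A -> W}) (X Y : W) (pi : {rmorphism R -> W}) :
  is_ambiskew alpha alphaV v iotaR x y ->
  gwa_relations alpha alphaV w iotaW X Y ->
  (forall a, pi (iotaR a) = iotaW a) -> pi x = X -> pi y = Y ->
  forall r, normal_form iotaW X Y (pi r).
Proof.
move=> [S [j [y0 [beta [delta [k [S_skew _ _ R_skew [iotaE yE]]]]]]]] W_rel.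
move=> pi_A pi_x pi_y.
have nf0 : normal_form iotaW X Y 0.
  by have := normal_formX iotaW X Y 0 0; rewrite rmorph0 mul0r.
apply: (skew_poly_ind R_skew) => [|a b|b i]; rewrite ?rmorph0 ?rmorphD //.
  exact: normal_formD.
rewrite rmorphM rmorphXn pi_x; move: b.
apply: (skew_poly_ind S_skew) => [|a b|b l]; rewrite ?rmorph0 ?mul0r //.
  by rewrite !rmorphD mulrDl; apply: normal_formD.
rewrite !rmorphM !rmorphXn -yE -iotaE pi_A pi_y.
exact: normal_formYX W_rel _ _ _.
Qed.

(** * The homomorphism to matrices of size m = n + 1, its kernel and its image *)

Section MatrixRepresentation.
Variables (K : fieldType) (A D : algType K) (alpha alphaV : {lrmorphism A -> A}).
Hypotheses (alphaK : cancel alpha alphaV) (alphaVK : cancel alphaV alpha).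
Variables (pi : {lrmorphism A -> D}) (n : nat) (w : A) (d : nat -> K).
Hypothesis pi_w : forall i, pi (iter i alpha w) = (d i)%:A.
Hypotheses (d0 : d 0 = 0) (dn : d n.+1 = 0).
Hypothesis d_neq0 : forall i, (0 < i <= n)%N -> d i != 0.

Let S : nzRingType := 'M[D]_n.+1.
Implicit Types i j : 'I_n.+1.

Definition rho (a : A) : S :=
  \matrix_(i, j) (if i == j then pi (iter i alpha a) else 0).

Definition Ymx : S := \matrix_(i, j) (j == i.+1 :> nat)%:R.

Definition Xmx : S := \matrix_(i, j) (if (i == j.+1 :> nat) then (d i)%:A else 0).

Lemma pi_iter_linear l c a b : pi (iter l alpha (c *: a + b)) =
  c *: pi (iter l alpha a) + pi (iter l alpha b).
Proof.
have -> : iter l alpha (c *: a + b) = c *: iter l alpha a + iter l alpha b.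
  by elim: l => //= l ->; rewrite linearP.
by rewrite linearP.
Qed.

Lemma pi_iterM l a b :
  pi (iter l alpha (a * b)) = pi (iter l alpha a) * pi (iter l alpha b).
Proof.
have -> : iter l alpha (a * b) = iter l alpha a * iter l alpha b.
  by elim: l => //= l ->; rewrite rmorphM.
by rewrite rmorphM.
Qed.

Lemma pi_iter1 l : pi (iter l alpha 1) = 1.
Proof.
have -> : iter l alpha 1 = 1 by elim: l => //= l ->; rewrite rmorph1.
by rewrite rmorph1.
Qed.

Lemma sum_single (F : 'I_n.+1 -> D) (k : 'I_n.+1) :
  (forall l, l != k -> F l = 0) -> \sum_l F l = F k.
Proof. by move=> F0; rewrite (bigD1 k) //= big1 ?addr0. Qed.

Lemma rho_mulE a (B : S) i j : (rho a * B) i j = pi (iter i alpha a) * B i j.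
Proof.
rewrite mxE (sum_single (k := i)) => [|l li]; first by rewrite mxE eqxx.
by rewrite mxE eq_sym (negPf li) mul0r.
Qed.

Lemma mul_rhoE a (B : S) i j : (B * rho a) i j = B i j * pi (iter j alpha a).
Proof.
rewrite mxE (sum_single (k := j)) => [|l /negPf lj]; first by rewrite mxE eqxx.
by rewrite mxE lj mulr0.
Qed.

Fact rho_is_zmod_morphism : zmod_morphism rho.
Proof.
move=> a b; apply/matrixP => i j; rewrite !mxE; case: eqP => _; last by rewrite subr0.
by have := pi_iter_linear i (-1) b a; rewrite !scaleN1r ![- _ + _]addrC.
Qed.

Fact rho_is_monoid_morphism : monoid_morphism rho.
Proof.
split=> [|a b]; apply/matrixP => i j.
  by rewrite !mxE pi_iter1; case: eqP.
rewrite rho_mulE !mxE; case: eqP => [_|_]; last by rewrite mulr0.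
by rewrite pi_iterM.
Qed.

HB.instance Definition _ := GRing.isZmodMorphism.Build A S rho rho_is_zmod_morphism.
HB.instance Definition _ := GRing.isMonoidMorphism.Build A S rho rho_is_monoid_morphism.

Lemma rho_gwa_relations : gwa_relations alpha alphaV w (rho : {rmorphism A -> S}) Xmx Ymx.
Proof.
have iterVK (i : nat) a : iter i.+1 alpha (alphaV a) = iter i alpha a.
  by rewrite iterSr alphaVK.
split=> [||a|a]; apply/matrixP => i j.
(* The last row of [Ymx] is zero, so the corner entry of the product is 0 and must equal [d n.+1].
   In the next relation the first row of [Xmx] likewise forces [d 0] to be 0. *)
- rewrite !mxE -iterSr pi_w; have [i_n|i_n] := eqVneq (i : nat) n.
    rewrite i_n dn scale0r big1 ?if_same // => l _; rewrite !mxE.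
    by rewrite i_n (ltn_eqF (ltn_ord l)) mul0r.
  have iS : (i.+1 < n.+1)%N by have := ltn_ord i; lia.
  rewrite (sum_single (k := Ordinal iS)) => [|l li]; rewrite !mxE /=.
    by rewrite eqxx mul1r eqSS.
  by rewrite -(inj_eq val_inj) /= in li; rewrite (negPf li) mul0r.
- rewrite !mxE pi_w; case: (posnP i) => [i0|i_gt0].
    rewrite i0 d0 scale0r big1 ?if_same // => l _.
    by rewrite !mxE i0 mul0r.
  have iP : (i.-1 < n.+1)%N by have := ltn_ord i; lia.
  rewrite (sum_single (k := Ordinal iP)) => [|l li]; rewrite !mxE /=.
    rewrite prednK // eqxx -(inj_eq val_inj) /= eq_sym.
    by case: eqP => _; rewrite ?mulr1 ?mulr0.
  rewrite -(inj_eq val_inj) /= in li; case: eqP => [iE|_]; last by rewrite mul0r.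
  by rewrite iE eqxx in li.
- rewrite mul_rhoE rho_mulE !mxE; case: eqP => [->|_]; last by rewrite mul0r mulr0.
  by rewrite iterSr mul1r mulr1.
- rewrite mul_rhoE rho_mulE !mxE; case: eqP => [iE|_]; last by rewrite mul0r mulr0.
  by rewrite {2}iE iterVK mulr_algl mulr_algr.
Qed.

Lemma Ymx_exp k i j : (Ymx ^+ k) i j = (j == (i + k)%N :> nat)%:R.
Proof.
elim: k i j => [|k IHk] i j; first by rewrite !mxE addn0 eq_sym.
rewrite exprSr mxE addnS; case: (posnP j) => [j0|j_gt0].
  by rewrite j0 big1 // => l _; rewrite mxE j0 mulr0.
have jP : (j.-1 < n.+1)%N by have := ltn_ord j; lia.
rewrite (sum_single (k := Ordinal jP)) => [|l lj]; rewrite IHk !mxE /=.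
  by rewrite prednK // eqxx mulr1 -eqSS prednK.
rewrite -(inj_eq val_inj) /= in lj; case: (j =P l.+1 :> nat) => [jE|_].
  by rewrite jE eqxx in lj.
by rewrite mulr0.
Qed.

(** The product d_i d_(i-1) ... d_(i-k+1), which is the entry of [Xmx ^+ k] at (i, i-k). *)
Fixpoint xi (i k : nat) : K := if k is k'.+1 then d i * xi i.-1 k' else 1.

Lemma xi_neq0 (i k : nat) : (k <= i <= n)%N -> xi i k != 0.
Proof.
elim: k i => [|k IHk] i ki /=; first exact: oner_neq0.
by rewrite mulf_neq0 ?d_neq0 ?IHk //; lia.
Qed.

Lemma Xmx_exp k i j :
  (Xmx ^+ k) i j = if (i == (j + k)%N :> nat) then (xi i k)%:A else 0.
Proof.
elim: k i j => [|k IHk] i j.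
  by rewrite !mxE addn0 scale1r -(inj_eq val_inj); case: eqP.
rewrite exprS mxE addnS; case: (posnP i) => [i0|i_gt0].
  by rewrite i0 big1 // => l _; rewrite mxE i0 mul0r.
have iP : (i.-1 < n.+1)%N by have := ltn_ord i; lia.
rewrite (sum_single (k := Ordinal iP)) => [|l li]; rewrite IHk !mxE /=.
  rewrite prednK // eqxx -[in RHS](prednK i_gt0) eqSS prednK //.
  by case: eqP => _; rewrite ?mulr0 // mulr_algl scalerA.
rewrite -(inj_eq val_inj) /= in li; case: (i =P l.+1 :> nat) => [iE|_].
  by rewrite iE eqxx in li.
by rewrite mul0r.
Qed.

Section Kernel.
Variables (W : nzRingType) (iota : {rmorphism A -> W}) (X Y : W).
Variable g : {rmorphism W -> S}.
Hypotheses (g_iota : forall a, g (iota a) = rho a) (gX : g X = Xmx) (gY : g Y = Ymx).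
Variable M : set A.
Hypothesis pi_ker : forall a, pi a = 0 <-> M a.

Lemma iter_alphaVM l a : (iter l alphaV @` M) a <-> pi (iter l alpha a) = 0.
Proof.
have iterK (f h : A -> A) : cancel f h -> cancel (iter l f) (iter l h).
  by move=> fK; elim: l => // l IHl b; rewrite iterSr iterS fK IHl.
split=> [[b Mb <-]|/pi_ker Ma].
  by rewrite iterK // pi_ker.
by exists (iter l alpha a) => //; rewrite iterK.
Qed.

(** The indices [l] with l + k <= n are the rows met by the k-th superdiagonal. In [coef_negP] they
    are the rows met by the k-th subdiagonal. *)
Lemma coef_posP k a : coef_pos alphaV M n.+1 k a <->
  forall l, (l + k <= n)%N -> pi (iter l alpha a) = 0.
Proof.
rewrite /coef_pos; case: leqP => nk; last by split=> // _ l lk; exfalso; lia.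
split=> [Ma l lk|Ma l /= lk]; last by apply/iter_alphaVM/Ma; lia.
by apply/iter_alphaVM/Ma => /=; lia.
Qed.

Lemma coef_negP k a : coef_neg alphaV M n.+1 k a <->
  forall l, (k <= l <= n)%N -> pi (iter l alpha a) = 0.
Proof.
rewrite /coef_neg; case: leqP => nk; last by split=> // _ l lk; exfalso; lia.
split=> [Ma l lk|Ma l /= lk]; last by apply/iter_alphaVM/Ma; lia.
by apply/iter_alphaVM/Ma => /=; lia.
Qed.

Lemma g_iotaY a k i j : g (iota a * Y ^+ k) i j =
  if (j == (i + k)%N :> nat) then pi (iter i alpha a) else 0.
Proof.
rewrite rmorphM rmorphXn g_iota gY rho_mulE Ymx_exp.
by case: eqP => _; rewrite ?mulr1 ?mulr0.
Qed.

Lemma g_iotaX a k i j : g (iota a * X ^+ k) i j =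
  if (i == (j + k)%N :> nat) then xi i k *: pi (iter i alpha a) else 0.
Proof.
rewrite rmorphM rmorphXn g_iota gX rho_mulE Xmx_exp.
by case: eqP => _; rewrite ?mulr_algr ?mulr0.
Qed.

Lemma g_normal_form N a b i j :
  g (\sum_(0 <= k < N) iota (a k) * Y ^+ k +
     \sum_(1 <= k < N) iota (b k) * X ^+ k) i j =
  \sum_(0 <= k < N) (if (j == (i + k)%N :> nat) then pi (iter i alpha (a k)) else 0) +
  \sum_(1 <= k < N)
    (if (i == (j + k)%N :> nat) then xi i k *: pi (iter i alpha (b k)) else 0).
Proof.
rewrite rmorphD !rmorph_sum mxE !summxE.
by congr (_ + _); apply: eq_bigr => k _; rewrite ?g_iotaX ?g_iotaY.
Qed.

(** Terms of different degrees occupy different diagonals, so [g r] vanishes exactly when each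
    coefficient is killed in every row of its diagonal. For negative degrees the extra scalar [xi]
    is nonzero and can be cancelled. *)
Lemma g_ker r : normal_form iota X Y r -> (g r = 0 <-> ideal_J alphaV iota X Y M n.+1 r).
Proof.
move=> [N [a [b rE]]]; split=> [/matrixP gr|[N' [a' [b' [a'M b'M ->]]]]]; last first.
  apply/matrixP => i j; rewrite g_normal_form mxE.
  rewrite !big1 ?addr0 // => k _; case: eqP => // kE.
    have /coef_negP -> := b'M k; first by rewrite scaler0.
    by have := ltn_ord i; lia.
  by have /coef_posP -> := a'M k; last by have := ltn_ord j; lia.
have pi_iter0 l : pi (iter l alpha 0) = 0.
  by have := pi_iter_linear l (-1) 0 0; rewrite scaler0 addr0 scaleN1r addNr.
(* Membership in [ideal_J] constrains the coefficients at all indices, even those absent from the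
   sums, so these are reset to 0. *)
exists N, (fun k => if (k < N)%N then a k else 0),
  (fun k => if (0 < k < N)%N then b k else 0); split=> [k|k|].
- apply/coef_posP => l lk; case: ifP => kN; last exact: pi_iter0.
  have lt_l : (l < n.+1)%N by lia.
  have lt_lk : (l + k < n.+1)%N by lia.
  have := gr (Ordinal lt_l) (Ordinal lt_lk).
  rewrite rE g_normal_form mxE [X in _ + X]big1_seq ?addr0 => [|i' /andP[_ i'N]].
    rewrite (bigD1_seq k) ?iota_uniq ?mem_index_iota //= eqxx big1 ?addr0 //.
    by move=> i' i'k; rewrite eqn_add2l eq_sym (negPf i'k).
  rewrite mem_index_iota in i'N; case: eqP => //= lE; exfalso; lia.
- apply/coef_negP => l lk; case: ifP => kN; last exact: pi_iter0.
  have lt_l : (l < n.+1)%N by lia.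
  have lt_lk : (l - k < n.+1)%N by lia.
  have := gr (Ordinal lt_l) (Ordinal lt_lk).
  rewrite rE g_normal_form mxE [X in X + _]big1_seq ?add0r => [|i' _]; last first.
    by case: eqP => //= lE; exfalso; lia.
  rewrite (bigD1_seq k) ?iota_uniq ?mem_index_iota //= subnK; last by lia.
  rewrite eqxx big1 ?addr0 => [/eqP|i' i'k]; last first.
    by case: eqP => // lE; case/eqP: i'k; lia.
  by rewrite scaler_eq0 (negPf (xi_neq0 _)) => [/eqP|]; last lia.
- rewrite rE; congr (_ + _); rewrite !big_nat.
    by apply: eq_bigr => k /andP[_ ->].
  by apply: eq_bigr => k ->.
Qed.

Lemma g_surj : (forall f, exists a, pi a = f) -> forall B : S, exists r, g r = B.
Proof.
move=> pi_surj B.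
have entry i j (f : D) :
    exists r, g r = \matrix_(k, l) (if (k == i) && (l == j) then f else 0).
  pose s := xi i i * xi n (n - j).
  have s0 : s != 0 by rewrite mulf_neq0 ?xi_neq0 //; have := ltn_ord i; lia.
  have [a0 a0E] := pi_surj (s^-1 *: f).
  have iterK b : iter i alpha (iter i alphaV b) = b.
    by elim: (i : nat) => // l IHl; rewrite iterSr iterS alphaVK.
  (* [Y ^+ n] maps to the matrix unit E_(0,n). The right factor moves its column from n to j, the
     left one its row from 0 to i, with total scalar [s]. In row [i] the image of [a] is
     [pi (iter i alpha a)], whence the inverse iterate of [alpha]. *)
  exists (iota (iter i alphaV a0) * X ^+ i * (Y ^+ n * X ^+ (n - j))).
  have YXE k l : (Ymx ^+ n * Xmx ^+ (n - j)) k l =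
      if (k == 0 :> nat) && (l == j) then (xi n (n - j))%:A else 0.
    rewrite mxE (sum_single (k := ord_max)) => [|l' l'n]; rewrite Ymx_exp Xmx_exp.
      rewrite /= -{1}[n]add0n eqn_add2r eq_sym; case: eqP => _ /=; last by rewrite mul0r.
      rewrite mul1r -(inj_eq val_inj) /=.
      by have -> : (n == l + (n - j))%N = (l == j :> nat) by have := ltn_ord j; lia.
    rewrite -(inj_eq val_inj) /= in l'n; case: eqP => l'E; last by rewrite mul0r.
    by case/eqP: l'n; have := ltn_ord l'; lia.
  apply/matrixP => k l; rewrite rmorphM !rmorphM !rmorphXn gX gY mxE.
  rewrite (sum_single (k := ord0)) => [|l' l'0]; last first.
    by rewrite YXE -(inj_eq val_inj) /= in l'0 *; rewrite (negPf l'0) mulr0.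
  rewrite g_iota rho_mulE YXE Xmx_exp /= add0n (inj_eq val_inj).
  rewrite [RHS]mxE; case: eqP => [->|_] /=; last by rewrite mulr0 mul0r.
  case: eqP => _; last by rewrite mulr0.
  rewrite iterK a0E !mulr_algr !scalerA [xi n _ * _]mulrC.
  by rewrite divff ?scale1r.
have sum_img (I : Type) (r : seq I) (F : I -> S) :
    (forall e, exists x, g x = F e) -> exists x, g x = \sum_(i <- r) F i.
  move=> /choice[h hE]; exists (\sum_(i <- r) h i).
  by rewrite rmorph_sum; apply: eq_bigr.
have -> : B = \sum_i \sum_j \matrix_(k, l) (if (k == i) && (l == j) then B i j else 0).
  apply/matrixP => k l; rewrite summxE (sum_single (k := k)) => [|k' k'k].
    rewrite summxE (sum_single (k := l)) => [|l' l'l]; first by rewrite mxE !eqxx.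
    by rewrite mxE eq_sym (negPf l'l) andbF.
  by rewrite summxE big1 // => l' _; rewrite mxE eq_sym (negPf k'k).
by apply: (sum_img) => i; apply: (sum_img) => j; apply: entry.
Qed.
End Kernel.
End MatrixRepresentation.

(** * The scalars d_i and their vanishing *)

Section WeylParameters.
Variables (K : fieldType) (p : nat) (q sq eps : K) (n : nat).
Hypotheses (p_odd : odd p) (q_neq0 : q != 0) (sq_sqrt : sq ^+ 2 = q).
Hypothesis q_not_root1 : forall k, (0 < k)%N -> q ^+ k != 1.
Hypothesis eps_pm1 : eps = 1 \/ eps = -1.

Definition root_M : K := eps * qpow4 sq (p%:Z + 2 * n.+1%:Z - 3).

(* [z_p - root_M] is sent to zero, and [weyl_value i] is the image of
   alpha^i(u + lambda) *)
Definition weyl_value (i : nat) : K :=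
  q ^+ (p.-1)./2 * (q ^+ i / root_M) + q * (root_M / q ^+ i)
  + lambda_eps p q sq n.+1 eps.

Let sq_neq0 : sq != 0.
Proof. by apply: contraNneq q_neq0 => s0; rewrite -sq_sqrt s0 expr0n. Qed.

Let eps_neq0 : eps != 0.
Proof. by case: eps_pm1 => ->; rewrite ?oppr_eq0 oner_neq0. Qed.

Let pE : p = (p./2).*2.+1.
Proof. by rewrite -[LHS]odd_double_half p_odd. Qed.

Lemma root_ME : root_M = eps * (sq ^+ p./2 * sq ^+ n).
Proof.
rewrite /root_M /qpow4 -exprD; congr (_ * _).
by have -> : ((p%:Z + 2 * n.+1%:Z - 3) %/ 2)%Z = (p./2 + n)%N by lia.
Qed.

Lemma root_M_neq0 : root_M != 0.
Proof. by rewrite root_ME !mulf_neq0 ?expf_neq0. Qed.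

(** Let c = eps q^((p-2m+1)/4), with m = n + 1. Because 1/eps = eps, the first two summands of
    [weyl_value i] are c q^i and c q^(m-i). The constant -c (q^m + 1) is the one that makes the sum
    factor. *)
Lemma weyl_value_factor i : (i <= n.+1)%N -> weyl_value i =
  - eps * (sq ^+ p./2 / sq ^+ n) * (q ^+ i - 1) * (q ^+ (n.+1 - i) - 1).
Proof.
move=> i_n; rewrite /weyl_value root_ME /lambda_eps /qpow4.
have -> : ((p%:Z - 2 * n.+1%:Z + 1) %/ 2)%Z = (p./2)%:Z + - n%:Z by lia.
have -> : (p.-1)./2 = p./2 by have := pE; lia.
rewrite expfzDr // -exprnN -exprnP.
have -> : q ^+ (n.+1 - i) = sq ^+ n ^+ 2 * sq ^+ 2 / q ^+ i.
  apply: (mulIf (expf_neq0 i q_neq0)); rewrite divfK ?expf_neq0 //.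
  by rewrite -exprD subnK // -sq_sqrt -!exprM -exprD; congr (_ ^+ _); lia.
have -> : q ^+ n.+1 = sq ^+ n ^+ 2 * sq ^+ 2.
  by rewrite -sq_sqrt -!exprM -exprD; congr (_ ^+ _); lia.
have -> : q ^+ p./2 = sq ^+ p./2 ^+ 2.
  by rewrite -sq_sqrt -!exprM mulnC.
rewrite -[X in _ + X * _ + _]sq_sqrt.
have := expf_neq0 i q_neq0; have := expf_neq0 n sq_neq0.
have := expf_neq0 p./2 sq_neq0.
set H := sq ^+ p./2; set B := sq ^+ n; set I := q ^+ i => H0 B0 I0.
(* Splitting on the sign lets [field] see that eps^2 = 1. *)
by case: eps_pm1 => ->; field; rewrite ?oppr_eq0 ?oner_neq0 ?H0 ?B0 ?I0.
Qed.

Lemma weyl_value_eq0 i : (i <= n.+1)%N ->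
  (weyl_value i == 0) = (i == 0%N) || (i == n.+1).
Proof.
move=> i_n; rewrite weyl_value_factor // !mulf_eq0 oppr_eq0 invr_eq0.
rewrite (negPf eps_neq0) !(negPf (expf_neq0 _ sq_neq0)) !subr_eq0 /=.
have qX1 k : (q ^+ k == 1) = (k == 0%N).
  by case: k => [|k]; rewrite ?expr0 ?eqxx //; rewrite (negPf (q_not_root1 _)).
by rewrite !qX1; congr (_ || _); lia.
Qed.
End WeylParameters.

Theorem corollary4p10
  (K : closedFieldType) (p : nat) (p_odd : odd p)
  (q : K) (q_neq0 : q != 0)
  (q_not_root1 : forall n, (0 < n)%N -> q ^+ n != 1)
  (sq : K) (sq_sqrt : sq ^+ 2 = q)
  (A : algType K) (z zV : nat -> A) (A_torus : is_quantum_torus p q z zV)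
  (alpha alphaV : {lrmorphism A -> A})
  (alphaK : cancel alpha alphaV) (alphaVK : cancel alphaV alpha)
  (alpha_even : forall i, (1 <= i <= p)%N -> ~~ odd i -> alpha (z i) = z i)
  (alpha_odd : forall i, (1 <= i <= p)%N -> odd i ->
     alpha (z i) = q^-1 *: z i)
  (u : A) (u_def : u = torus_u p q z zV)
  (v : A) (v_def : v = u - alpha u)
  (R : nzRingType) (iotaR : {rmorphism A -> R}) (x y : R)
  (R_ambiskew : is_ambiskew alpha alphaV v iotaR x y)
  (m : nat) (m_ge1 : (1 <= m)%N)
  (eps : K) (eps_pm1 : eps = 1 \/ eps = -1)
  (lam : K) (lam_def : lam = lambda_eps p q sq m eps)
  (W : nzRingType) (iotaW : {rmorphism A -> W}) (X Y : W)
  (W_gwa : is_gwa alpha alphaV (u + lam%:A) iotaW X Y)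
  (pi : {rmorphism R -> W})
  (pi_quotient :
     is_quotient_ring (right_multiples (x * y - iotaR u - iotaR lam%:A)) pi)
  (pi_A : forall a, pi (iotaR a) = iotaW a)
  (pi_x : pi x = X) (pi_y : pi y = Y) :
  quotient_has_right_goldie_rank
    (pi @^-1` ideal_J alphaV iotaW X Y
                (right_multiples (gen_M p sq m eps z)) m) m.
Proof.
have p_gt0 : (0 < p)%N by apply: contraLR p_odd; rewrite lt0n negbK => /eqP->.
have pp : (1 <= p <= p)%N by rewrite p_gt0 leqnn.
case: m m_ge1 lam_def => // n _ lamE.
(* With m = n + 1, [gen_M] unfolds to [z p - t%:A], so its right multiples are the kernel of the map
   to [D]. *)
pose t := root_M p sq eps n.
have t0 : t != 0 := root_M_neq0 n p_odd q_neq0 sq_sqrt eps_pm1.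
have [D [pi' [pi'_surj pi'_ker ore]]] := torus_quotient p_odd q_neq0 A_torus t0.
have piD a b : pi' (a + b) = pi' a + pi' b by exact: raddfD.
have piZ c a : pi' (c *: a) = c *: pi' a by exact: linearZ.
have piM a b : pi' (a * b) = pi' a * pi' b by exact: rmorphM.
have pi1 : pi' 1 = 1 by exact: rmorph1.
have pi'_z : pi' (z p) = t%:A.
  apply/eqP; rewrite -subr_eq0; apply/eqP.
  have /pi'_ker : right_multiples (z p - t%:A) (z p - t%:A) by exists 1; rewrite ?mulr1.
  by rewrite -scaleN1r piD !piZ pi1 scaleN1r.
have [zK zVK] := A_torus.1.1 p pp.
have pi'_zV : pi' (zV p) = (t^-1)%:A.
  have E : t *: pi' (zV p) = 1 by rewrite -[pi' _]mul1r scalerAl -pi'_z -piM zK.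
  by rewrite -[LHS](scalerK t0) E.
have alpha_z i : iter i alpha (z p) = q ^- i *: z p.
  elim: i => [|i IHi] /=; first by rewrite expr0 invr1 scale1r.
  by rewrite IHi linearZ /= alpha_odd // scalerA exprSr invfM.
(* The action of [alpha] is prescribed on [z] alone; on the inverse it follows by applying the
   iterate to [zV p * z p = 1]. *)
have alpha_zV i : iter i alpha (zV p) = q ^+ i *: zV p.
  have iterM a b : iter i alpha (a * b) = iter i alpha a * iter i alpha b.
    by elim: i => //= i ->; rewrite rmorphM.
  have iter1 : iter i alpha 1 = 1 by elim: i {iterM} => //= i ->; rewrite rmorph1.
  have := iterM (zV p) (z p); rewrite zVK iter1 alpha_z -scalerAr => E.
  have qi0 : q ^+ i != 0 by rewrite expf_neq0.
  rewrite -[LHS]mulr1 -zK mulrA.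
  by rewrite -[iter _ _ _ * z p](scalerKV qi0) -E -scalerAl mul1r.
have pi'_w i : pi' (iter i alpha (u + lam%:A)) = (weyl_value p q sq eps n i)%:A.
  have iterL c a b : iter i alpha (c *: a + b) = c *: iter i alpha a + iter i alpha b.
    by elim: i => //= i ->; rewrite linearP.
  have iter1 : iter i alpha 1 = 1 by elim: i {iterL} => //= i ->; rewrite rmorph1.
  have iter0 : iter i alpha 0 = 0 by elim: i {iterL iter1} => //= i ->; rewrite rmorph0.
  rewrite u_def /torus_u -addrA iterL -[q *: z p + _]addrC iterL iter1 -[q *: _]addr0.
  rewrite iterL iter0 addr0 alpha_z alpha_zV !piD !piZ pi'_z pi'_zV pi1.
  by rewrite !scalerA -!scalerDl /weyl_value lamE -/t; congr (_ *: _); ring.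
have w_eq0 := @weyl_value_eq0 _ _ _ _ _ n p_odd q_neq0 sq_sqrt q_not_root1 eps_pm1.
have w0 : weyl_value p q sq eps n 0 = 0 by apply/eqP; rewrite w_eq0.
have wn : weyl_value p q sq eps n n.+1 = 0 by apply/eqP; rewrite w_eq0 ?eqxx ?orbT.
have w_neq0 i : (0 < i <= n)%N -> weyl_value p q sq eps n i != 0.
  by move=> i_n; rewrite w_eq0; lia.
have [g [[g_iota gX gY] _]] := gwa_univ W_gwa
  (rho_gwa_relations alphaVK pi'_w w0 wn).
have nf r := ambiskew_normal_form R_ambiskew (gwa_rel W_gwa) pi_A pi_x pi_y r.
have [pi_surj _] := pi_quotient.
exists 'M[D]_n.+1, (g \o pi : {rmorphism R -> 'M[D]_n.+1}); split; last first.
  exact: matrix_right_goldie_rank.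
split=> [B|r].
  have [w' <-] := g_surj alphaVK w_neq0 g_iota gX gY pi'_surj B.
  by have [r <-] := pi_surj w'; exists r.
exact: (g_ker alphaK alphaVK w_neq0 g_iota gX gY pi'_ker (nf r)).
Qed.
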